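(* Let $-1\le B<A\le 1$ with $B\neq 0$. For every $f\in\mathcal{S}^*(A,B)$, the logarithmic coefficients $\gamma_n$ of $f$ satisfy $$|\gamma_{n}|\le \frac{A-B}{2n}\quad\text{for all } n\ge 1,$$ and $$\sum_{n=1}^{\infty}|\gamma_{n}|^{2} \leq \left(\frac{A-B}{2B}\right)^2 \mathrm{Li}_{2}(B^2).$$ Both inequalities are sharp: for each $n\ge1$, the function $k_{A,B;n}(z)= z(1+Bz^n)^{(A-B)/(nB)}$ belongs to $\mathcal{S}^*(A,B)$ and gives equality in the first inequality for the index $n$, and the function $k_{A,B;1}$ gives equality in the second inequality.
   Context: $\mathbb{D}=\{z\in\mathbb{C}:|z|<1\}$. $\mathcal{A}$ is the class of analytic functions $f$ on $\mathbb{D}$ with $f(0)=f'(0)-1=0$. For analytic $F,G$ in $\mathbb{D}$, $F\prec G$ ($F$ is subordinate to $G$) means there is an analytic $\phi$ on $\mathbb{D}$ with $\phi(0)=0$, $|\phi(z)|<1$ on $\mathbb{D}$ and $F=G\circ\phi$. For $-1\le B<A\le 1$, $$\mathcal{S}^*(A,B)=\left\{f\in\mathcal{A}:\ \frac{zf'(z)}{f(z)}\prec\frac{1+Az}{1+Bz},\ z\in\mathbb{D}\right\}$$ (in particular $zf'/f$ is analytic in $\mathbb{D}$, so $f(z)/z$ is nonvanishing). The logarithmic coefficients $\gamma_n=\gamma_n(f)$ are defined by $\log\frac{f(z)}{z}=2\sum_{n=1}^\infty\gamma_n z^n$ for $z\in\mathbb{D}$, with the branch of the logarithm vanishing at $z=0$.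 $\mathrm{Li}_2(x)=\sum_{n=1}^\infty \frac{x^n}{n^2}$ is the dilogarithm. Powers are principal branches (value $1$ at $z=0$). *)

(* Defs.v *)
From Stdlib Require Import Reals.
From Coquelicot Require Import Coquelicot.
Open Scope R_scope.

Definition in_disc (z : C) : Prop := Cmod z < 1.

(* Functions on the disc are total functions on C; only their values on the
   disc are ever used.  Analytic means: around every point of the disc the
   function is the sum of a convergent power series. *)
Definition analytic_on_disc (f : C -> C) : Prop :=
  forall w : C, in_disc w ->
  exists (a : nat -> C) (r : R), 0 < r /\
    forall z : C, Cmod (z - w) < r ->
      @is_series C_AbsRing C_NormedModule
        (fun k : nat => (a k * (z - w) ^ k)%C) (f z).

Definition class_A (f : C -> C) : Prop :=
  analytic_on_disc f /\ f (RtoC 0) = RtoC 0 /\ C_derive f (RtoC 0) = RtoC 1.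

Definition subordinate (F G : C -> C) : Prop :=
  exists phi : C -> C,
    analytic_on_disc phi /\ phi (RtoC 0) = RtoC 0 /\
    forall z : C, in_disc z -> Cmod (phi z) < 1 /\ F z = G (phi z).

(* The function p is z f'(z) / f(z) with its removable singularity at 0
   filled in: division by zero is total in Coquelicot, so the quotient itself
   carries no information at z = 0. *)
Definition starlike_class (A B : R) (f : C -> C) : Prop :=
  class_A f /\
  (forall z : C, in_disc z -> z <> RtoC 0 -> f z <> RtoC 0) /\
  exists p : C -> C,
    analytic_on_disc p /\
    (forall z : C, in_disc z -> z <> RtoC 0 ->
       p z = (z * C_derive f z / f z)%C) /\
    subordinate p (fun z : C => ((1 + A * z) / (1 + B * z))%C).

Definition Cexp (z : C) : C := (exp (Re z) * cos (Im z), exp (Re z) * sin (Im z)).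

(* Principal argument, with values in (-PI, PI]; meaningful for w <> 0. *)
Definition Carg (w : C) : R :=
  if Rle_dec 0 (Im w) then acos (Re w / Cmod w) else - acos (Re w / Cmod w).

Definition Clog (w : C) : C := (ln (Cmod w), Carg w).

Definition Cpower (w a : C) : C := Cexp (a * Clog w)%C.

(* L is the branch of log (f(z)/z) on the disc vanishing at 0; at z = 0 the
   function f(z)/z is understood as f'(0) = 1. *)
Definition is_log_branch (f L : C -> C) : Prop :=
  analytic_on_disc L /\ L (RtoC 0) = RtoC 0 /\
  forall z : C, in_disc z -> z <> RtoC 0 -> Cexp (L z) = (f z / z)%C.

(* Only gamma n with n >= 1 matters: the entry gamma 0 is unconstrained. *)
Definition log_coeffs (f : C -> C) (gamma : nat -> C) : Prop :=
  exists L : C -> C, is_log_branch f L /\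
    forall z : C, in_disc z ->
      @is_series C_AbsRing C_NormedModule
        (fun k : nat => (2 * (gamma (S k) * z ^ S k))%C) (L z).

Definition Li2 (x : R) : R := Series (fun k : nat => x ^ S k / INR (S k) ^ 2).

Definition kfun (A B : R) (n : nat) (z : C) : C :=
  (z * Cpower (1 + B * z ^ n) (RtoC ((A - B) / (INR n * B))))%C.

(* Main.v *)
Require Import Defs.
From Stdlib Require Import Reals.
From Coquelicot Require Import Coquelicot.
From Stdlib Require Import Lra Lia Psatz.
Open Scope R_scope.

(** If [f] is in the class and [L = log (f (z) / z)], then
    [z f' / f = 1 + z L'], so the subordination says that
    [q = z L' / (A - B)] equals [phi / (1 + B phi)] for a Schwarz function
    [phi].  The coefficients of [q] are [2 k gamma_k / (A - B)], and
    [phi = q / (1 - B q)], that is, [|q| <= |1 - B q|] on the disc.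

    Both inequalities come from Clunie's coefficient comparison
    ([clunie_step]): with [Q_n] the partial sum of [q] of degree below [n],
    [phi (1 - B Q_n)] agrees with [Q_(n+1)] up to order [n] and is dominated by
    [1 - B Q_n], so Parseval's identity on circles gives
    [sum_(k <= n) |q_k|^2 <= 1 + B^2 sum_(k < n) |q_k|^2].
    Since [B^2 <= 1] this yields [|q_n| <= 1], which is the first inequality.
    By induction the partial sums of [|q_k|^2] are at most those of
    [B^(2 (k - 1))], the squared coefficients of [w / (1 + B w)]; summation by
    parts against the decreasing weights [1 / k^2] turns this into the bound by
    the dilogarithm ([abel_majorization]).

    The comparison needs [phi] to be expandable on each circle.  Here
    [|q| <= |1 - B q|] forces [Re (1 - B q) >= 1/2], so that [1 / (1 - B q)] is
    a uniform limit of polynomials on every smaller disc, by a Neumann series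
    ([poly_limit_inv]).  For polynomials, Parseval's identity is a finite sum
    over roots of unity ([circle_parseval]).

    For sharpness, [z f' / f] for [f = kfun A B n] is
    [(1 + A z^n) / (1 + B z^n)], and [log (f / z)] is an explicit multiple of
    the logarithmic series at [B z^n], from which the coefficients are read
    off.  That these functions are analytic in the sense of having a power
    series at every point of the disc follows from recentring a series at the
    origin ([power_series_recenter]); the series of [kfun A B n] itself is the
    binomial series ([binomial_series_Cpower]). *)

(** * Finite sums *)

Fixpoint csum (a : nat -> C) (n : nat) : C :=
  match n with
  | O => RtoC 0
  | S m => (csum a m + a m)%C
  end.

Fixpoint rsum (a : nat -> R) (n : nat) : R :=
  match n with
  | O => 0
  | S m => rsum a m + a m
  end.

Lemma csum_ext (a b : nat -> C) (n : nat) :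
  (forall k, (k < n)%nat -> a k = b k) -> csum a n = csum b n.
Proof.
  induction n as [|n IH]; intros H; simpl; [reflexivity|].
  rewrite IH by (intros; apply H; lia). now rewrite H by lia.
Qed.

Lemma csum_plus (a b : nat -> C) (n : nat) :
  csum (fun k => a k + b k)%C n = (csum a n + csum b n)%C.
Proof. induction n as [|n IH]; simpl; [|rewrite IH]; ring. Qed.

Lemma csum_scal (c : C) (a : nat -> C) (n : nat) :
  csum (fun k => c * a k)%C n = (c * csum a n)%C.
Proof. induction n as [|n IH]; simpl; [|rewrite IH]; ring. Qed.

Lemma csum_zero (n : nat) : csum (fun _ => RtoC 0) n = RtoC 0.
Proof. induction n as [|n IH]; simpl; [|rewrite IH]; ring. Qed.

Lemma csum_add (a : nat -> C) (m n : nat) :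
  csum a (m + n) = (csum a m + csum (fun k => a (m + k)%nat) n)%C.
Proof.
  induction n as [|n IH]; simpl.
  - rewrite Nat.add_0_r. ring.
  - rewrite Nat.add_succ_r. simpl. rewrite IH. ring.
Qed.

Lemma csum_shift (a : nat -> C) (n : nat) :
  csum a (S n) = (a O + csum (fun k => a (S k)) n)%C.
Proof.
  change (S n) with (1 + n)%nat. rewrite csum_add. simpl. ring.
Qed.

Lemma csum_exchange (a : nat -> nat -> C) (m n : nat) :
  csum (fun j => csum (a j) n) m = csum (fun k => csum (fun j => a j k) m) n.
Proof.
  induction m as [|m IH]; simpl.
  - symmetry. apply csum_zero.
  - rewrite IH. now rewrite csum_plus.
Qed.

Lemma csum_bound (a : nat -> C) (b : nat -> R) (n : nat) :
  (forall k, (k < n)%nat -> Cmod (a k) <= b k) -> Cmod (csum a n) <= rsum b n.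
Proof.
  induction n as [|n IH]; intros H; simpl.
  - rewrite Cmod_0. lra.
  - eapply Rle_trans; [apply Cmod_triangle|].
    apply Rplus_le_compat; [apply IH; intros|]; apply H; lia.
Qed.

Lemma rsum_ext (a b : nat -> R) (n : nat) :
  (forall k, (k < n)%nat -> a k = b k) -> rsum a n = rsum b n.
Proof.
  induction n as [|n IH]; intros H; simpl; [reflexivity|].
  rewrite IH by (intros; apply H; lia). now rewrite H by lia.
Qed.

Lemma rsum_le (a b : nat -> R) (n : nat) :
  (forall k, (k < n)%nat -> a k <= b k) -> rsum a n <= rsum b n.
Proof.
  induction n as [|n IH]; intros H; simpl; [lra|].
  apply Rplus_le_compat; [apply IH; intros|]; apply H; lia.
Qed.

Lemma rsum_plus (a b : nat -> R) (n : nat) :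
  rsum (fun k => a k + b k) n = rsum a n + rsum b n.
Proof. induction n as [|n IH]; simpl; [|rewrite IH]; ring. Qed.

Lemma rsum_scal (c : R) (a : nat -> R) (n : nat) :
  rsum (fun k => c * a k) n = c * rsum a n.
Proof. induction n as [|n IH]; simpl; [|rewrite IH]; ring. Qed.

Lemma rsum_const (c : R) (n : nat) : rsum (fun _ => c) n = INR n * c.
Proof.
  induction n as [|n IH]; [simpl; ring|].
  rewrite S_INR. simpl rsum. rewrite IH. ring.
Qed.

Lemma rsum_add (a : nat -> R) (m n : nat) :
  rsum a (m + n) = rsum a m + rsum (fun k => a (m + k)%nat) n.
Proof.
  induction n as [|n IH].
  - rewrite Nat.add_0_r. simpl. ring.
  - rewrite Nat.add_succ_r. simpl. rewrite IH. ring.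
Qed.

Lemma rsum_shift (a : nat -> R) (n : nat) :
  rsum a (S n) = a O + rsum (fun k => a (S k)) n.
Proof.
  change (S n) with (1 + n)%nat. rewrite rsum_add. simpl. ring.
Qed.

Lemma rsum_incr (a : nat -> R) (m n : nat) :
  (forall k, 0 <= a k) -> (m <= n)%nat -> rsum a m <= rsum a n.
Proof.
  intros Ha Hmn. induction Hmn as [|n Hmn IH]; [lra|].
  simpl. specialize (Ha n). lra.
Qed.

Lemma rsum_nonneg (a : nat -> R) (n : nat) :
  (forall k, 0 <= a k) -> 0 <= rsum a n.
Proof. intros Ha. apply (rsum_incr a 0 n Ha). lia. Qed.

(** * Parseval on the roots of unity *)

Lemma geometric_csum (v : C) (n : nat) :
  ((1 - v) * csum (fun j => v ^ j) n = 1 - v ^ n)%C.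
Proof.
  induction n as [|n IH].
  - simpl. ring.
  - simpl csum. rewrite Cmult_plus_distr_l, IH, Cpow_S. ring.
Qed.

Definition unit_root (N : nat) : C := Cexp (0, 2 * PI / INR N).

Lemma Cexp_plus (a b : C) : Cexp (a + b) = (Cexp a * Cexp b)%C.
Proof.
  destruct a as [a1 a2], b as [b1 b2]. unfold Cexp, Cmult, Cplus; simpl.
  rewrite exp_plus, cos_plus, sin_plus. f_equal; ring.
Qed.

Lemma Cexp_0 : Cexp (RtoC 0) = RtoC 1.
Proof.
  unfold Cexp, RtoC; simpl. rewrite exp_0, cos_0, sin_0. f_equal; ring.
Qed.

Lemma Cexp_imag_pow (t : R) (n : nat) : (Cexp (0, t) ^ n)%C = Cexp (0, INR n * t).
Proof.
  induction n as [|n IH].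
  - simpl. rewrite Rmult_0_l. symmetry. apply Cexp_0.
  - rewrite Cpow_S, IH, <- Cexp_plus, S_INR. f_equal.
    unfold Cplus; simpl. f_equal; ring.
Qed.

Lemma Cmod_Cexp (z : C) : Cmod (Cexp z) = exp (Re z).
Proof.
  assert (H : Cmod (Cexp z) ^ 2 = exp (Re z) ^ 2).
  { rewrite Cmod2_alt. unfold Cexp; simpl.
    generalize (sin2_cos2 (Im z)). unfold Rsqr. intros H.
    replace (_ + _) with
      (exp (Re z) * exp (Re z) * (sin (Im z) * sin (Im z) + cos (Im z) * cos (Im z)))
      by ring.
    rewrite H. ring. }
  apply Rsqr_inj; [apply Cmod_ge_0|left; apply exp_pos|].
  unfold Rsqr. simpl in H. lra.
Qed.

Lemma Cmod_unit_root (N : nat) : Cmod (unit_root N) = 1.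
Proof. unfold unit_root. rewrite Cmod_Cexp. apply exp_0. Qed.

Lemma unit_root_primitive (N d : nat) :
  (0 < d < N)%nat -> (unit_root N ^ d)%C <> RtoC 1.
Proof.
  intros [H0 H1] H. unfold unit_root in H. rewrite Cexp_imag_pow in H.
  apply (f_equal Re) in H. unfold Cexp in H; simpl in H.
  rewrite exp_0, Rmult_1_l in H.
  apply lt_INR in H0. apply lt_INR in H1. simpl in H0.
  generalize PI_RGT_0; intros HPI.
  set (t := INR d / INR N).
  assert (Ht : 0 < t < 1).
  { unfold t. split; [apply Rdiv_lt_0_compat; lra|].
    apply Rmult_lt_reg_r with (INR N); [lra|]. field_simplify; lra. }
  replace (INR d * (2 * PI / INR N)) with (2 * (PI * t)) in H
    by (unfold t; field; lra).
  rewrite cos_2a_sin in H.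
  assert (Hs : 0 < sin (PI * t)) by (apply sin_gt_0; nra).
  nra.
Qed.

Lemma unit_root_pow_order (N : nat) : (0 < N)%nat -> (unit_root N ^ N)%C = RtoC 1.
Proof.
  intros H. apply lt_INR in H. simpl in H.
  unfold unit_root. rewrite Cexp_imag_pow.
  replace (INR N * (2 * PI / INR N)) with (2 * PI) by (field; lra).
  unfold Cexp; simpl. rewrite exp_0, cos_2PI, sin_2PI. unfold RtoC. f_equal; ring.
Qed.

Lemma Cmult_conj_unit (w : C) : Cmod w = 1 -> (w * Cconj w)%C = RtoC 1.
Proof.
  intros H. rewrite <- Cmod2_conj, H. apply f_equal. ring.
Qed.

Definition circle_pt (r : R) (N j : nat) : C := (r * unit_root N ^ j)%C.

Lemma Cmod_circle_pt (r : R) (N j : nat) : 0 <= r -> Cmod (circle_pt r N j) = r.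
Proof.
  intros Hr. unfold circle_pt.
  rewrite Cmod_mult, Cmod_pow, Cmod_unit_root, pow1, Cmod_R, Rabs_pos_eq; lra.
Qed.

(** At the [j]-th point the summand is a constant times [v ^ j], with [v] an
    [N]-th root of unity other than 1; such a geometric sum vanishes. *)
Lemma circle_orthogonal (r : R) (N k m : nat) :
  (k < m < N)%nat ->
  csum (fun j => circle_pt r N j ^ k * Cconj (circle_pt r N j ^ m))%C N = RtoC 0.
Proof.
  intros [Hkm HmN].
  set (w := unit_root N). set (v := (Cconj w ^ (m - k))%C).
  assert (Hw : (w * Cconj w)%C = RtoC 1) by apply Cmult_conj_unit, Cmod_unit_root.
  assert (Hv : v <> RtoC 1).
  { intros H. apply (unit_root_primitive N (m - k)); [lia|].
    apply (f_equal Cconj) in H. unfold v in H.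
    rewrite Cpow_conj, Cconj_conj in H. fold w. rewrite H.
    unfold Cconj, RtoC; simpl. now rewrite Ropp_0. }
  assert (HvN : (v ^ N)%C = RtoC 1).
  { unfold v. rewrite <- Cpow_mult_r, Nat.mul_comm, Cpow_mult_r.
    rewrite <- Cpow_conj. unfold w. rewrite unit_root_pow_order by lia.
    replace (Cconj (RtoC 1)) with (RtoC 1)
      by (unfold Cconj, RtoC; simpl; now rewrite Ropp_0).
    apply Cpow_1_l. }
  rewrite csum_ext with (b := fun j => (RtoC r ^ k * RtoC r ^ m * v ^ j)%C).
  - rewrite (csum_scal _ (fun j => v ^ j)%C).
    assert (H := geometric_csum v N). rewrite HvN in H.
    replace (1 - 1)%C with (RtoC 0) in H by ring.
    assert (Hz : csum (fun j => (v ^ j)%C) N = RtoC 0).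
    { destruct (Ceq_dec (csum (fun j => (v ^ j)%C) N) 0) as [e|ne]; [exact e|].
      exfalso. revert H. apply Cmult_neq_0; [|exact ne].
      apply Cminus_eq_contra. congruence. }
    rewrite Hz. ring.
  - intros j _. unfold circle_pt. fold w.
    rewrite Cpow_conj, Cmult_conj, !Cpow_mult_l.
    replace (Cconj (RtoC r)) with (RtoC r)
      by (unfold Cconj, RtoC; simpl; now rewrite Ropp_0).
    rewrite (Cpow_conj w j).
    unfold v. rewrite <- !Cpow_mult_r.
    replace (j * m)%nat with (j * k + (m - k) * j)%nat by nia.
    rewrite Cpow_add_r.
    transitivity (RtoC r ^ k * RtoC r ^ m * ((w * Cconj w) ^ (j * k) * Cconj w ^ ((m - k) * j)))%C.
    + rewrite Cpow_mult_l. ring.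
    + rewrite Hw, Cpow_1_l. ring.
Qed.

Lemma Cmod_sq_plus (a b : C) :
  Cmod (a + b) ^ 2 = Cmod a ^ 2 + Cmod b ^ 2 + 2 * Re (a * Cconj b).
Proof.
  rewrite !Cmod2_alt. destruct a, b. unfold Cmult, Cconj, Cplus; simpl. ring.
Qed.

Lemma rsum_Re (a : nat -> C) (n : nat) : rsum (fun k => Re (a k)) n = Re (csum a n).
Proof. induction n as [|n IH]; simpl; [|rewrite IH]; reflexivity. Qed.

Definition poly_eval (a : nat -> C) (n : nat) (z : C) : C :=
  csum (fun k => a k * z ^ k)%C n.

(** The [N]-th roots of unity do the work of the integral over the circle: the
    powers below [N] are orthogonal on them, so the identity is exact for
    polynomials with at most [N] coefficients. *)
Lemma circle_parseval (r : R) (N M : nat) (a : nat -> C) :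
  0 <= r -> (M <= N)%nat ->
  rsum (fun j => Cmod (poly_eval a M (circle_pt r N j)) ^ 2) N
  = INR N * rsum (fun k => Cmod (a k) ^ 2 * r ^ (2 * k)) M.
Proof.
  intros Hr. induction M as [|M IH]; intros HM.
  - unfold poly_eval. simpl. rewrite Cmod_0, rsum_const. ring.
  - unfold poly_eval; simpl csum; fold (poly_eval a M).
    rewrite rsum_ext with (b := fun j =>
      Cmod (poly_eval a M (circle_pt r N j)) ^ 2 + Cmod (a M) ^ 2 * r ^ (2 * M)
      + 2 * Re (poly_eval a M (circle_pt r N j)
                * Cconj (a M * circle_pt r N j ^ M))).
    2:{ intros j _. change (csum (fun k => (a k * circle_pt r N j ^ k)%C) M)
          with (poly_eval a M (circle_pt r N j)).
        rewrite Cmod_sq_plus, Cmod_mult, Cmod_pow, Cmod_circle_pt by easy.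
        rewrite Rpow_mult_distr, <- pow_mult, (Nat.mul_comm M 2). ring. }
    rewrite !rsum_plus, IH, rsum_const, rsum_scal, rsum_Re by lia.
    replace (csum _ N) with (RtoC 0).
    { change (Re (RtoC 0)) with 0. cbn [rsum]. ring. }
    symmetry.
    rewrite csum_ext with (b := fun j =>
      csum (fun k => Cconj (a M) * (a k * (circle_pt r N j ^ k * Cconj (circle_pt r N j ^ M))))%C M).
    2:{ intros j _. unfold poly_eval. set (z := circle_pt r N j).
        rewrite (csum_ext
          (fun k => Cconj (a M) * (a k * (z ^ k * Cconj (z ^ M))))%C
          (fun k => Cconj (a M * z ^ M) * (a k * z ^ k))%C)
          by (intros; rewrite Cmult_conj; ring).
        rewrite csum_scal. ring. }
    (* the new monomial is orthogonal to each of the previous ones *)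
    rewrite csum_exchange.
    rewrite csum_ext with (b := fun _ => RtoC 0); [apply csum_zero|].
    intros k Hk. rewrite !csum_scal, circle_orthogonal by lia. ring.
Qed.

(** * Convergence of complex series *)

(** Equivalent to [is_series] over [C_NormedModule] ([has_sum_is_series]).
    The uniform structure of [C] has squares as balls, whereas all estimates
    here are in the modulus. *)
Definition has_sum (a : nat -> C) (l : C) : Prop :=
  forall eps : R, 0 < eps ->
  exists N : nat, forall n, (N <= n)%nat -> Cmod (csum a n - l) < eps.

Lemma sum_n_csum (a : nat -> C) (n : nat) :
  @sum_n C_AbelianMonoid a n = csum a (S n).
Proof.
  induction n as [|n IH].
  - rewrite sum_O. simpl. ring.
  - rewrite sum_Sn, IH. reflexivity.
Qed.

Lemma sum_n_rsum (a : nat -> R) (n : nat) : sum_n a n = rsum a (S n).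
Proof.
  induction n as [|n IH].
  - rewrite sum_O. simpl. ring.
  - rewrite sum_Sn, IH. reflexivity.
Qed.

Lemma has_sum_is_series (a : nat -> C) (l : C) :
  has_sum a l <-> @is_series C_AbsRing C_NormedModule a l.
Proof.
  unfold is_series, has_sum. split.
  - intros H P [eps HP].
    destruct (H eps (cond_pos eps)) as [N HN].
    exists N. intros n Hn. apply HP.
    change (@ball C_UniformSpace l eps (@sum_n C_AbelianMonoid a n)).
    rewrite sum_n_csum.
    assert (Hb := HN (S n) ltac:(lia)).
    assert (Hm := Rmax_Cmod (csum a (S n) - l)%C).
    assert (H1 := Rmax_l (Rabs (fst (csum a (S n) - l)%C)) (Rabs (snd (csum a (S n) - l)%C))).
    assert (H2 := Rmax_r (Rabs (fst (csum a (S n) - l)%C)) (Rabs (snd (csum a (S n) - l)%C))).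
    split.
    + change (Rabs (fst (csum a (S n)) - fst l) < eps).
      change (fst (csum a (S n) - l)%C) with (fst (csum a (S n)) - fst l) in *. lra.
    + change (Rabs (snd (csum a (S n)) - snd l) < eps).
      change (snd (csum a (S n) - l)%C) with (snd (csum a (S n)) - snd l) in *. lra.
  - intros H eps Heps.
    assert (He : 0 < eps / 2) by lra.
    destruct (H (@ball C_UniformSpace l (mkposreal _ He))) as [N HN].
    { exists (mkposreal _ He). easy. }
    exists (S N). intros [|n] Hn; [lia|].
    specialize (HN n ltac:(lia)).
    change (@ball C_UniformSpace l (eps / 2) (@sum_n C_AbelianMonoid a n)) in HN.
    rewrite sum_n_csum in HN. destruct HN as [H1 H2].
    change (Rabs (fst (csum a (S n)) - fst l) < eps / 2) in H1.
    change (Rabs (snd (csum a (S n)) - snd l) < eps / 2) in H2.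
    eapply Rle_lt_trans; [apply Cmod_2Rmax|].
    change (fst (csum a (S n) - l)%C) with (fst (csum a (S n)) - fst l).
    change (snd (csum a (S n) - l)%C) with (snd (csum a (S n)) - snd l).
    assert (Hs : sqrt 2 < 2).
    { rewrite <- (sqrt_square 2) at 2 by lra. apply sqrt_lt_1; lra. }
    assert (Hs0 := sqrt_pos 2).
    assert (Hmax : Rmax (Rabs (fst (csum a (S n)) - fst l)) (Rabs (snd (csum a (S n)) - snd l)) < eps / 2)
      by now apply Rmax_lub_lt.
    assert (Hmax0 := Rmax_l (Rabs (fst (csum a (S n)) - fst l)) (Rabs (snd (csum a (S n)) - snd l))).
    assert (Ha := Rabs_pos (fst (csum a (S n)) - fst l)).
    nra.
Qed.

Lemma has_sum_ext (a b : nat -> C) (l : C) :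
  (forall k, a k = b k) -> has_sum a l -> has_sum b l.
Proof.
  intros E H eps Heps. destruct (H eps Heps) as [N HN]. exists N.
  intros n Hn. rewrite <- (csum_ext a b) by auto. auto.
Qed.

Lemma Cmod_eq_small (a b : C) :
  (forall eps, 0 < eps -> Cmod (a - b) <= eps) -> a = b.
Proof.
  intros H. apply Ceq_minus, Cmod_eq_0.
  destruct (Rle_lt_or_eq_dec 0 (Cmod (a - b)) (Cmod_ge_0 _)) as [h|h]; [|easy].
  assert (H1 := H (Cmod (a - b) / 2) ltac:(lra)). lra.
Qed.

Lemma has_sum_unique (a : nat -> C) (l m : C) :
  has_sum a l -> has_sum a m -> l = m.
Proof.
  intros H1 H2. apply Cmod_eq_small. intros eps Heps.
  destruct (H1 (eps / 2) ltac:(lra)) as [N1 HN1].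
  destruct (H2 (eps / 2) ltac:(lra)) as [N2 HN2].
  assert (h1 := HN1 (N1 + N2)%nat ltac:(lia)).
  assert (h2 := HN2 (N1 + N2)%nat ltac:(lia)).
  replace (l - m)%C with
    (- (csum a (N1 + N2) - l) + (csum a (N1 + N2) - m))%C by ring.
  eapply Rle_trans; [apply Cmod_triangle|]. rewrite Cmod_opp. lra.
Qed.

Lemma has_sum_plus (a b : nat -> C) (l m : C) :
  has_sum a l -> has_sum b m -> has_sum (fun k => a k + b k)%C (l + m)%C.
Proof.
  intros H1 H2 eps Heps.
  destruct (H1 (eps / 2) ltac:(lra)) as [N1 HN1].
  destruct (H2 (eps / 2) ltac:(lra)) as [N2 HN2].
  exists (N1 + N2)%nat. intros n Hn.
  assert (h1 := HN1 n ltac:(lia)). assert (h2 := HN2 n ltac:(lia)).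
  rewrite csum_plus.
  replace (csum a n + csum b n - (l + m))%C with
    ((csum a n - l) + (csum b n - m))%C by ring.
  eapply Rle_lt_trans; [apply Cmod_triangle|]. lra.
Qed.

Lemma has_sum_scal (c : C) (a : nat -> C) (l : C) :
  has_sum a l -> has_sum (fun k => c * a k)%C (c * l)%C.
Proof.
  intros H eps Heps.
  assert (Hc := Cmod_ge_0 c).
  destruct (H (eps / (Cmod c + 1))) as [N HN]; [apply Rdiv_lt_0_compat; lra|].
  exists N. intros n Hn. specialize (HN n Hn).
  rewrite csum_scal. replace (c * csum a n - c * l)%C with (c * (csum a n - l))%C by ring.
  rewrite Cmod_mult.
  assert (Hm := Cmod_ge_0 (csum a n - l)%C).
  apply Rle_lt_trans with ((Cmod c + 1) * Cmod (csum a n - l)); [nra|].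
  apply (Rmult_lt_compat_l (Cmod c + 1)) in HN; [|lra].
  replace ((Cmod c + 1) * (eps / (Cmod c + 1))) with eps in HN by (field; lra). lra.
Qed.

Lemma has_sum_drop (a : nat -> C) (l : C) (m : nat) :
  has_sum a l <-> has_sum (fun k => a (m + k)%nat) (l - csum a m)%C.
Proof.
  split; intros H eps Heps; destruct (H eps Heps) as [N HN].
  - exists N. intros n Hn. specialize (HN (m + n)%nat ltac:(lia)).
    rewrite csum_add in HN.
    replace (csum (fun k => a (m + k)%nat) n - (l - csum a m))%C with
      (csum a m + csum (fun k => a (m + k)%nat) n - l)%C by ring. exact HN.
  - exists (m + N)%nat. intros n Hn. specialize (HN (n - m)%nat ltac:(lia)).
    replace n with (m + (n - m))%nat by lia. rewrite csum_add.
    replace (csum (fun k => a (m + k)%nat) (n - m) - (l - csum a m))%C with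
      (csum a m + csum (fun k => a (m + k)%nat) (n - m) - l)%C in HN by ring. exact HN.
Qed.

Lemma has_sum_csum_bound (a : nat -> C) (l c : C) (M : R) (N0 : nat) :
  has_sum a l -> (forall n, (N0 <= n)%nat -> Cmod (csum a n - c) <= M) -> Cmod (l - c) <= M.
Proof.
  intros H Hb. apply Rnot_lt_le. intros Hlt.
  destruct (H (Cmod (l - c) - M) ltac:(lra)) as [N HN].
  specialize (HN (N + N0)%nat ltac:(lia)). specialize (Hb (N + N0)%nat ltac:(lia)).
  assert (Ht := Cmod_triangle (csum a (N + N0) - c)%C (- (csum a (N + N0) - l))%C).
  rewrite Cmod_opp in Ht.
  replace (csum a (N + N0) - c + - (csum a (N + N0) - l))%C with (l - c)%C in Ht by ring.
  lra.
Qed.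

Lemma rsum_limit (b : nat -> R) (s : R) :
  is_series b s -> forall eps, 0 < eps ->
  exists N, forall n, (N <= n)%nat -> Rabs (rsum b n - s) < eps.
Proof.
  intros H eps Heps.
  destruct (H (ball s (mkposreal _ Heps))) as [N HN]; [now exists (mkposreal _ Heps)|].
  exists (S N). intros [|n] Hn; [lia|].
  specialize (HN n ltac:(lia)). rewrite sum_n_rsum in HN. exact HN.
Qed.

Lemma rsum_le_Series (b : nat -> R) (n : nat) :
  (forall k, 0 <= b k) -> ex_series b -> rsum b n <= Series b.
Proof.
  intros Hb Hs. apply Rnot_lt_le. intros Hlt.
  destruct (rsum_limit b (Series b) (Series_correct b Hs) (rsum b n - Series b)
    ltac:(lra)) as [N HN].
  specialize (HN (N + n)%nat ltac:(lia)).
  assert (Hi := rsum_incr b n (N + n) Hb ltac:(lia)).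
  apply Rabs_def2 in HN. lra.
Qed.

Lemma series_tail_small (b : nat -> R) :
  (forall k, 0 <= b k) -> ex_series b -> forall eps, 0 < eps ->
  exists N, forall m n, (N <= m)%nat -> rsum (fun k => b (m + k)%nat) n <= eps.
Proof.
  intros Hb Hs eps Heps.
  destruct (rsum_limit b (Series b) (Series_correct b Hs) eps Heps) as [N HN].
  exists N. intros m n Hm.
  assert (Ha := rsum_add b m n).
  assert (Hl := rsum_le_Series b (m + n) Hb Hs).
  specialize (HN m Hm). apply Rabs_def2 in HN. lra.
Qed.

Lemma has_sum_zero : has_sum (fun _ => RtoC 0) (RtoC 0).
Proof.
  intros eps Heps. exists O. intros n _. rewrite csum_zero.
  replace (0 - 0)%C with (RtoC 0) by ring. now rewrite Cmod_0.
Qed.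

Lemma has_sum_at_0 (a : nat -> C) : has_sum (fun k => a k * 0 ^ k)%C (a O).
Proof.
  apply (has_sum_drop _ _ 1%nat).
  replace (a O - csum (fun k => a k * 0 ^ k) 1)%C with (RtoC 0) by (simpl; ring).
  apply has_sum_ext with (2 := has_sum_zero). intros k. simpl. ring.
Qed.

Definition CSeries (a : nat -> C) : C :=
  (Series (fun k => Re (a k)), Series (fun k => Im (a k))).

Lemma im_le_Cmod (z : C) : Rabs (Im z) <= Cmod z.
Proof. eapply Rle_trans; [|apply Rmax_Cmod]. apply Rmax_r. Qed.

Lemma Cmod_le_Re_Im (z : C) : Cmod z <= Rabs (Re z) + Rabs (Im z).
Proof.
  replace z with (RtoC (Re z) + Ci * RtoC (Im z))%C at 1.
  - eapply Rle_trans; [apply Cmod_triangle|].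
    rewrite Cmod_mult, Cmod_Ci, !Cmod_R. lra.
  - destruct z. unfold Cplus, Cmult, Ci, RtoC; simpl. f_equal; ring.
Qed.

Lemma csum_components (a : nat -> C) (n : nat) :
  csum a n = (rsum (fun k => Re (a k)) n, rsum (fun k => Im (a k)) n).
Proof. induction n as [|n IH]; simpl; [|rewrite IH]; reflexivity. Qed.

Lemma has_sum_dominated (a : nat -> C) (b : nat -> R) :
  (forall k, Cmod (a k) <= b k) -> ex_series b -> has_sum a (CSeries a).
Proof.
  intros Hab Hb.
  assert (Hr : ex_series (fun k => Re (a k))).
  { apply (@ex_series_le R_AbsRing R_CompleteNormedModule) with b; [|exact Hb].
    intros n. eapply Rle_trans; [apply re_le_Cmod|apply Hab]. }
  assert (Hi : ex_series (fun k => Im (a k))).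
  { apply (@ex_series_le R_AbsRing R_CompleteNormedModule) with b; [|exact Hb].
    intros n. eapply Rle_trans; [apply im_le_Cmod|apply Hab]. }
  intros eps Heps.
  destruct (rsum_limit _ _ (Series_correct _ Hr) (eps / 2) ltac:(lra)) as [N1 HN1].
  destruct (rsum_limit _ _ (Series_correct _ Hi) (eps / 2) ltac:(lra)) as [N2 HN2].
  exists (N1 + N2)%nat. intros n Hn.
  specialize (HN1 n ltac:(lia)). specialize (HN2 n ltac:(lia)).
  eapply Rle_lt_trans; [apply Cmod_le_Re_Im|].
  rewrite csum_components. unfold CSeries.
  unfold Cminus, Cplus, Copp. cbn [Re Im fst snd]. unfold Rminus in *. lra.
Qed.

Lemma has_sum_tail_bound (a : nat -> C) (l : C) (M : R) (m : nat) :
  has_sum a l -> (forall n, rsum (fun k => Cmod (a (m + k)%nat)) n <= M) ->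
  Cmod (l - csum a m) <= M.
Proof.
  intros H Hb. apply (has_sum_csum_bound a l _ M m H).
  intros n Hn. replace n with (m + (n - m))%nat by lia. rewrite csum_add.
  replace (_ + _ - _)%C with (csum (fun k => a (m + k)%nat) (n - m)) by ring.
  eapply Rle_trans; [|apply (Hb (n - m)%nat)]. now apply csum_bound.
Qed.

(** * Power series on the unit disc *)

Definition unit_series (a : nat -> C) (F : C -> C) : Prop :=
  forall z, in_disc z -> has_sum (fun k => a k * z ^ k)%C (F z).

(** At a radius [s] strictly between [r] and 1 the terms of the series are
    bounded, so at [r] they are dominated by the powers of [r / s]. *)
Lemma unit_series_abs (a : nat -> C) (F : C -> C) (r : R) :
  unit_series a F -> 0 <= r < 1 -> ex_series (fun k => Cmod (a k) * r ^ k).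
Proof.
  intros HF [Hr0 Hr1].
  set (s := (1 + r) / 2).
  assert (Hs : r < s < 1) by (unfold s; lra).
  assert (Hms : Cmod (RtoC s) = s) by (rewrite Cmod_R, Rabs_pos_eq; lra).
  destruct (HF (RtoC s)) with (eps := 1) as [N HN]; [unfold in_disc; lra|lra|].
  apply (ex_series_incr_n _ N).
  apply (@ex_series_le R_AbsRing R_CompleteNormedModule) with
    (b := fun k => (2 * (r / s) ^ N) * (r / s) ^ k).
  2:{ apply (@ex_series_scal R_AbsRing R_NormedModule (2 * (r / s) ^ N) (fun k => (r / s) ^ k)), ex_series_geom.
      assert (0 <= r / s) by (apply Rdiv_le_0_compat; lra).
      rewrite Rabs_pos_eq by easy. apply Rmult_lt_reg_r with s; [lra|]. field_simplify; lra. }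
  intros n. change (norm ?x) with (Rabs x).
  rewrite Rabs_pos_eq by (apply Rmult_le_pos; [apply Cmod_ge_0|now apply pow_le]).
  set (k := (N + n)%nat).
  assert (h1 := HN k ltac:(lia)). assert (h2 := HN (S k) ltac:(lia)).
  assert (h : Cmod (a k * s ^ k) < 2).
  { replace (a k * s ^ k)%C with
      ((csum (fun j => a j * s ^ j)%C (S k) - F s) +
       - (csum (fun j => a j * s ^ j)%C k - F s))%C by (simpl csum; ring).
    eapply Rle_lt_trans; [apply Cmod_triangle|]. rewrite Cmod_opp. lra. }
  rewrite Cmod_mult, Cmod_pow, Hms in h.
  rewrite Rmult_assoc, <- pow_add. fold k.
  replace (Cmod (a k) * r ^ k) with (Cmod (a k) * s ^ k * (r / s) ^ k).
  - apply Rmult_le_compat_r; [|lra]. apply pow_le, Rdiv_le_0_compat; lra.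
  - rewrite Rmult_assoc, <- Rpow_mult_distr. f_equal. f_equal. field. lra.
Qed.

(** * Expanding a power series about another centre *)

(** The coefficient of [h ^ j] in [(w + h) ^ k], by Pascal's recursion. *)
Fixpoint shift_coeff (w : C) (k j : nat) : C :=
  match k with
  | O => match j with O => RtoC 1 | S _ => RtoC 0 end
  | S k' => (w * shift_coeff w k' j +
             match j with O => RtoC 0 | S j' => shift_coeff w k' j' end)%C
  end.

Lemma shift_coeff_expand (w h : C) (k n : nat) :
  (k < n)%nat -> csum (fun j => shift_coeff w k j * h ^ j)%C n = ((w + h) ^ k)%C.
Proof.
  revert n. induction k as [|k IH]; intros [|n] Hn; try lia.
  - rewrite csum_shift. rewrite csum_ext with (b := fun _ => RtoC 0).
    + rewrite csum_zero. simpl. ring.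
    + intros j _. simpl. ring.
  - transitivity (w * csum (fun j => shift_coeff w k j * h ^ j) (S n)
                  + h * csum (fun j => shift_coeff w k j * h ^ j) n)%C.
    + rewrite (csum_shift _ n). rewrite (csum_shift (fun j => shift_coeff w k j * h ^ j)%C n).
      rewrite Cmult_plus_distr_l, <- !csum_scal, <- Cplus_assoc, <- csum_plus.
      f_equal; [simpl; ring|]. apply csum_ext. intros j _. simpl. ring.
    + rewrite !IH by lia. rewrite Cpow_S. ring.
Qed.

(** [shift_coeff w k j] is a binomial coefficient times [w ^ (k - j)], so the
    moduli expand [(|w| + s) ^ k]. *)
Lemma shift_coeff_majorant (w : C) (s : R) (k n : nat) :
  0 <= s -> rsum (fun j => Cmod (shift_coeff w k j) * s ^ j) n <= (Cmod w + s) ^ k.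
Proof.
  intros Hs. assert (Hw := Cmod_ge_0 w). revert n.
  assert (Hpos : forall k j, 0 <= Cmod (shift_coeff w k j) * s ^ j).
  { intros. apply Rmult_le_pos; [apply Cmod_ge_0|now apply pow_le]. }
  induction k as [|k IH]; intros n.
  - destruct n as [|n]; [simpl; lra|]. rewrite rsum_shift.
    rewrite rsum_ext with (b := fun _ => 0).
    + rewrite rsum_const. simpl. rewrite Cmod_1. lra.
    + intros j _. simpl. rewrite Cmod_0. ring.
  - destruct n as [|n]; [simpl rsum; apply pow_le; lra|].
    apply Rle_trans with
      (Cmod w * rsum (fun j => Cmod (shift_coeff w k j) * s ^ j) (S n)
       + s * rsum (fun j => Cmod (shift_coeff w k j) * s ^ j) n).
    + rewrite (rsum_shift _ n). rewrite (rsum_shift (fun j => Cmod (shift_coeff w k j) * s ^ j)).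
      rewrite Rmult_plus_distr_l, <- !rsum_scal, Rplus_assoc, <- rsum_plus.
      apply Rplus_le_compat.
      * simpl. rewrite Cplus_0_r, Cmod_mult. lra.
      * apply rsum_le. intros j _. simpl.
        assert (Ht := Cmod_triangle (w * shift_coeff w k (S j)) (shift_coeff w k j)).
        rewrite Cmod_mult in Ht.
        assert (0 <= s * s ^ j) by (apply Rmult_le_pos; [easy|now apply pow_le]).
        apply Rmult_le_compat_r with (r := s * s ^ j) in Ht; [|easy]. lra.
    + assert (h1 := IH (S n)). assert (h2 := IH n).
      change ((Cmod w + s) ^ S k) with ((Cmod w + s) * (Cmod w + s) ^ k).
      apply (Rmult_le_compat_l (Cmod w)) in h1; [|easy].
      apply (Rmult_le_compat_l s) in h2; [|easy]. lra.
Qed.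

Lemma shift_coeff_0 (w : C) (k : nat) : shift_coeff w k 0 = (w ^ k)%C.
Proof. induction k as [|k IH]; simpl; [|rewrite IH]; ring. Qed.

Lemma shift_coeff_1 (w : C) (k : nat) :
  shift_coeff w k 1 = (INR k * w ^ pred k)%C.
Proof.
  induction k as [|k IH]; [simpl; ring|].
  change (shift_coeff w (S k) 1) with (w * shift_coeff w k 1 + shift_coeff w k 0)%C.
  rewrite IH, shift_coeff_0, S_INR, RtoC_plus. simpl pred.
  destruct k as [|k]; [simpl; ring|]. simpl pred. rewrite Cpow_S. ring.
Qed.

Lemma shift_coeff_truncation (w h : C) (k J : nat) :
  Cmod ((w + h) ^ k - csum (fun j => shift_coeff w k j * h ^ j) J)%C
  <= (Cmod w + Cmod h) ^ k.
Proof.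
  rewrite <- (shift_coeff_expand w h k (J + S k)) by lia. rewrite csum_add.
  replace (_ + _ - _)%C with
    (csum (fun i => shift_coeff w k (J + i) * h ^ (J + i))%C (S k)) by ring.
  eapply Rle_trans; [|apply (shift_coeff_majorant w (Cmod h) k (J + S k)), Cmod_ge_0].
  set (b := fun j => Cmod (shift_coeff w k j) * Cmod h ^ j).
  rewrite (rsum_add b).
  assert (0 <= rsum b J).
  { apply rsum_nonneg. intros. apply Rmult_le_pos; [apply Cmod_ge_0|apply pow_le, Cmod_ge_0]. }
  assert (Hc : Cmod (csum (fun i => shift_coeff w k (J + i) * h ^ (J + i))%C (S k))
    <= rsum (fun i => b (J + i)%nat) (S k)).
  { apply csum_bound. intros i _. unfold b. rewrite Cmod_mult, Cmod_pow. lra. }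
  lra.
Qed.

Lemma has_sum_csum (a : nat -> nat -> C) (l : nat -> C) (n : nat) :
  (forall j, has_sum (a j) (l j)) ->
  has_sum (fun k => csum (fun j => a j k) n) (csum l n).
Proof.
  intros H. induction n as [|n IH].
  - apply has_sum_zero.
  - simpl. apply has_sum_plus; auto.
Qed.

(** Cut the expansions of all the powers [(w + h) ^ k] at order [J] in [h].
    The error vanishes for the terms with [k < J] and is at most
    [|a_k| (|w| + |h|) ^ k] for the others, hence at most a tail of a
    convergent series: the sums over [k] and [j] are exchanged only for finitely
    many [j]. *)
Lemma power_series_recenter (a : nat -> C) (F : C -> C) (w : C) :
  unit_series a F -> in_disc w ->
  exists b r, 0 < r /\
    (forall j, has_sum (fun k => a k * shift_coeff w k j)%C (b j)) /\
    forall h, Cmod h <= r -> has_sum (fun j => b j * h ^ j)%C (F (w + h)%C).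
Proof.
  unfold in_disc. intros HF Hw.
  set (r := (1 - Cmod w) / 2). set (rho := Cmod w + r).
  assert (Hw0 := Cmod_ge_0 w).
  assert (Hr : 0 < r) by (unfold r; lra).
  assert (Hrho : 0 <= rho < 1) by (unfold rho, r; lra).
  assert (Habs := unit_series_abs a F rho HF Hrho).
  assert (Hpos : forall k, 0 <= Cmod (a k) * rho ^ k).
  { intros. apply Rmult_le_pos; [apply Cmod_ge_0|apply pow_le; lra]. }
  set (b := fun j => CSeries (fun k => a k * shift_coeff w k j)%C).
  assert (Hb : forall j, has_sum (fun k => a k * shift_coeff w k j)%C (b j)).
  { intros j. apply has_sum_dominated with (b := fun k => / r ^ j * (Cmod (a k) * rho ^ k)).
    - intros k. rewrite Cmod_mult.
      assert (Hm := shift_coeff_majorant w r k (S j) ltac:(lra)). simpl in Hm.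
      assert (0 <= rsum (fun j => Cmod (shift_coeff w k j) * r ^ j) j).
      { apply rsum_nonneg. intros. apply Rmult_le_pos; [apply Cmod_ge_0|apply pow_le; lra]. }
      assert (Hrj : 0 < r ^ j) by now apply pow_lt.
      fold rho in Hm.
      assert (Hm' : Cmod (shift_coeff w k j) <= / r ^ j * rho ^ k).
      { apply Rmult_le_reg_r with (r ^ j); [easy|].
        replace (/ r ^ j * rho ^ k * r ^ j) with (rho ^ k) by (field; lra). lra. }
      assert (Ha := Cmod_ge_0 (a k)).
      apply (Rmult_le_compat_l _ _ _ Ha) in Hm'. lra.
    - apply (@ex_series_scal R_AbsRing R_NormedModule (/ r ^ j)
        (fun k => Cmod (a k) * rho ^ k)). exact Habs. }
  exists b, r. split; [easy|]. split; [exact Hb|].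
  intros h Hh eps Heps.
  destruct (series_tail_small _ Hpos Habs (eps / 2) ltac:(lra)) as [N HN].
  exists N. intros J HJ.
  assert (Hin : in_disc (w + h)).
  { unfold in_disc. eapply Rle_lt_trans; [apply Cmod_triangle|]. unfold rho in Hrho. lra. }
  set (t := fun k => (a k * ((w + h) ^ k - csum (fun j => shift_coeff w k j * h ^ j) J))%C).
  assert (Ht : has_sum t (F (w + h) + -1 * csum (fun j => b j * h ^ j) J)%C).
  { eapply has_sum_ext;
      [|apply has_sum_plus; [apply (HF _ Hin)|apply has_sum_scal, (has_sum_csum
          (fun j k => h ^ j * (a k * shift_coeff w k j)))%C]].
    - intros k. unfold t. cbv beta.
      rewrite (csum_ext (fun j => h ^ j * (a k * shift_coeff w k j))%C
        (fun j => a k * (shift_coeff w k j * h ^ j))%C) by (intros; ring).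
      rewrite csum_scal. ring.
    - intros j. rewrite Cmult_comm. apply has_sum_scal, Hb. }
  assert (Hz : csum t J = RtoC 0).
  { rewrite csum_ext with (b := fun _ => RtoC 0); [apply csum_zero|].
    intros k Hk. unfold t. rewrite shift_coeff_expand by easy. ring. }
  assert (Htail := has_sum_tail_bound t _ (eps / 2) J Ht).
  rewrite Hz in Htail.
  replace (F (w + h) + -1 * csum (fun j => b j * h ^ j) J - 0)%C with
    (- (csum (fun j => b j * h ^ j) J - F (w + h)))%C in Htail by ring.
  rewrite Cmod_opp in Htail.
  apply Rle_lt_trans with (eps / 2); [|lra]. apply Htail.
  intros n. eapply Rle_trans; [|apply (HN J n HJ)].
  apply rsum_le. intros k _. unfold t. rewrite Cmod_mult.
  apply Rmult_le_compat_l; [apply Cmod_ge_0|].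
  eapply Rle_trans; [apply shift_coeff_truncation|].
  apply pow_incr. assert (Hh0 := Cmod_ge_0 h). unfold rho. lra.
Qed.

Lemma unit_series_analytic (a : nat -> C) (F : C -> C) :
  unit_series a F -> analytic_on_disc F.
Proof.
  intros HF w Hw.
  destruct (power_series_recenter a F w HF Hw) as (b & r & Hr & _ & Hb).
  exists b, r. split; [easy|]. intros z Hz. apply has_sum_is_series.
  assert (H := Hb (z - w)%C ltac:(lra)).
  replace (w + (z - w))%C with z in H by ring. exact H.
Qed.

(** * Complex derivatives *)

(** The remainder is required to be quadratic in [h].  Sums of power series meet
    this, and the product and chain rules become algebra of remainders. *)
Definition cderiv (F : C -> C) (z d : C) : Prop :=
  exists M delta, 0 <= M /\ 0 < delta /\
    forall h, Cmod h <= delta -> Cmod (F (z + h) - F z - d * h)%C <= M * Cmod h ^ 2.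

Lemma unit_series_quadratic (c : nat -> C) (G : C -> C) :
  unit_series c G ->
  exists M, 0 <= M /\
    forall u, Cmod u <= 1 / 2 -> Cmod (G u - c 0%nat - c 1%nat * u)%C <= M * Cmod u ^ 2.
Proof.
  intros HG.
  assert (Hs := unit_series_abs c G (1 / 2) HG ltac:(lra)).
  assert (Hpos : forall k, 0 <= Cmod (c k) * (1 / 2) ^ k).
  { intros. apply Rmult_le_pos; [apply Cmod_ge_0|apply pow_le; lra]. }
  set (S := Series (fun k => Cmod (c k) * (1 / 2) ^ k)).
  assert (HS : forall n, rsum (fun k => Cmod (c k) * (1 / 2) ^ k) n <= S).
  { intros n. now apply rsum_le_Series. }
  exists (4 * S). split.
  - specialize (HS O). simpl in HS. lra.
  - intros u Hu. assert (Hu0 := Cmod_ge_0 u).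
    replace (G u - c 0%nat - c 1%nat * u)%C with
      (G u - csum (fun k => c k * u ^ k) 2)%C by (simpl; ring).
    apply has_sum_tail_bound; [apply HG; unfold in_disc; lra|].
    intros n.
    apply Rle_trans with
      (4 * Cmod u ^ 2 * rsum (fun k => Cmod (c (2 + k)%nat) * (1 / 2) ^ (2 + k)) n).
    + rewrite <- rsum_scal. apply rsum_le. intros k _.
      rewrite Cmod_mult, Cmod_pow, !pow_add.
      assert (Hc := Cmod_ge_0 (c (2 + k)%nat)).
      assert (Hp : Cmod u ^ k <= (1 / 2) ^ k) by now apply pow_incr.
      assert (Hq : 0 <= Cmod (c (2 + k)%nat) * Cmod u ^ 2) by (apply Rmult_le_pos; [easy|now apply pow_le]).
      apply (Rmult_le_compat_l _ _ _ Hq) in Hp.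
      replace (4 * Cmod u ^ 2 * (Cmod (c (2 + k)%nat) * ((1 / 2) ^ 2 * (1 / 2) ^ k))) with
        (Cmod (c (2 + k)%nat) * Cmod u ^ 2 * (1 / 2) ^ k) by field.
      lra.
    + replace (4 * S * Cmod u ^ 2) with (4 * Cmod u ^ 2 * S) by ring.
      apply Rmult_le_compat_l; [assert (0 <= Cmod u ^ 2) by (now apply pow_le); lra|].
      specialize (HS (2 + n)%nat). cbn [Nat.add] in HS. rewrite !rsum_shift in HS.
      assert (h0 := Hpos 0%nat). assert (h1 := Hpos 1%nat). cbn [Nat.add]. lra.
Qed.

(** The derivative at [z] is the linear coefficient of the series recentred at
    [z], and [shift_coeff z k 1 = k z ^ (k - 1)]. *)
Lemma unit_series_cderiv (a : nat -> C) (F : C -> C) (z : C) :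
  unit_series a F -> in_disc z ->
  exists d, cderiv F z d /\ has_sum (fun k => INR k * a k * z ^ pred k)%C d.
Proof.
  intros HF Hz.
  destruct (power_series_recenter a F z HF Hz) as (b & r & Hr & Hb & Hs).
  exists (b 1%nat). split.
  - assert (HG : unit_series (fun j => b j * r ^ j)%C (fun u => F (z + r * u)%C)).
    { intros u Hu. unfold in_disc in Hu.
      eapply has_sum_ext; [|apply Hs].
      - intros k. simpl. rewrite Cpow_mult_l. ring.
      - rewrite Cmod_mult, Cmod_R, Rabs_pos_eq by lra.
        assert (Hu0 := Cmod_ge_0 u). nra. }
    destruct (unit_series_quadratic _ _ HG) as (M & HM & HMu).
    assert (H0 : F z = b 0%nat).
    { assert (H := Hs (RtoC 0) ltac:(rewrite Cmod_0; lra)).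
      rewrite Cplus_0_r in H. exact (has_sum_unique _ _ _ H (has_sum_at_0 b)). }
    exists (M / r ^ 2), (r / 2).
    assert (Hr2 : 0 < r ^ 2) by now apply pow_lt.
    split; [apply Rdiv_le_0_compat; lra|]. split; [lra|].
    intros h Hh.
    assert (Hrc : RtoC r <> RtoC 0) by (intros e; apply RtoC_inj in e; lra).
    assert (Hm : Cmod (h / r)%C = Cmod h / r)
      by (rewrite Cmod_div, Cmod_R, Rabs_pos_eq; [easy|lra|easy]).
    specialize (HMu (h / r)%C).
    rewrite Hm in HMu.
    replace (F (z + h) - F z - b 1%nat * h)%C with
      (F (z + r * (h / r)) - b 0%nat * r ^ 0 - b 1%nat * r ^ 1 * (h / r))%C.
    + replace (M / r ^ 2 * Cmod h ^ 2) with (M * (Cmod h / r) ^ 2) by (field; lra).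
      apply HMu. apply Rmult_le_reg_r with r; [easy|]. field_simplify; lra.
    + replace (r * (h / r))%C with h by (field; easy).
      rewrite H0. simpl. field. easy.
  - eapply has_sum_ext; [|apply (Hb 1%nat)].
    intros k. cbv beta. rewrite shift_coeff_1. ring.
Qed.

Lemma cderiv_C_derive (F : C -> C) (z d : C) : cderiv F z d -> C_derive F z = d.
Proof.
  intros (M & delta & HM & Hdelta & H).
  apply is_C_lim_unique. intros P [eps HP].
  assert (He : 0 < Rmin delta (eps / (M + 1)) / 2).
  { assert (0 < Rmin delta (eps / (M + 1))); [|lra].
    apply Rmin_glb_lt; [easy|]. apply Rdiv_lt_0_compat; [apply cond_pos|lra]. }
  exists (mkposreal _ He). refine (fun (x : C) Hx Hne => HP _ _).
  destruct Hx as [Hx1 Hx2].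
  change (Rabs (fst x - fst z) < Rmin delta (eps / (M + 1)) / 2) in Hx1.
  change (Rabs (snd x - snd z) < Rmin delta (eps / (M + 1)) / 2) in Hx2.
  set (h := (x - z)%C).
  assert (Hh : Cmod h < Rmin delta (eps / (M + 1))).
  { eapply Rle_lt_trans; [apply Cmod_le_Re_Im|].
    change (Re h) with (fst x - fst z). change (Im h) with (snd x - snd z). lra. }
  assert (Hh0 : h <> RtoC 0) by (unfold h; now apply Cminus_eq_contra).
  assert (Hhp : 0 < Cmod h) by now apply Cmod_gt_0.
  assert (Hd1 := Rmin_l delta (eps / (M + 1))). assert (Hd2 := Rmin_r delta (eps / (M + 1))).
  specialize (H h ltac:(lra)).
  replace (z + h)%C with x in H by (unfold h; ring).
  assert (Hq : Cmod ((F x - F z) / h - d)%C < eps).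
  { replace ((F x - F z) / h - d)%C with ((F x - F z - d * h) / h)%C by (field; easy).
    rewrite Cmod_div by easy.
    apply Rle_lt_trans with (M * Cmod h).
    - apply Rmult_le_reg_r with (Cmod h); [easy|].
      replace (Cmod (F x - F z - d * h) / Cmod h * Cmod h)
        with (Cmod (F x - F z - d * h)) by (field; lra). lra.
    - assert (Hb : Cmod h < eps / (M + 1)) by lra.
      apply (Rmult_lt_compat_l (M + 1)) in Hb; [|lra].
      replace ((M + 1) * (eps / (M + 1))) with (pos eps) in Hb by (field; lra). lra. }
  assert (Hmx := Rmax_Cmod ((F x - F z) / h - d)%C).
  assert (H1 := Rmax_l (Rabs (fst ((F x - F z) / h - d)%C)) (Rabs (snd ((F x - F z) / h - d)%C))).
  assert (H2 := Rmax_r (Rabs (fst ((F x - F z) / h - d)%C)) (Rabs (snd ((F x - F z) / h - d)%C))).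
  split.
  - change (Rabs (fst ((F x - F z) / h - d)%C) < eps). lra.
  - change (Rabs (snd ((F x - F z) / h - d)%C) < eps). lra.
Qed.

Lemma cderiv_ext_loc (F G : C -> C) (z d : C) :
  (exists r, 0 < r /\ forall h, Cmod h <= r -> F (z + h)%C = G (z + h)%C) ->
  cderiv F z d -> cderiv G z d.
Proof.
  intros (s & Hs & E) (M & delta & HM & Hd & H).
  exists M, (Rmin delta s). split; [easy|]. split; [now apply Rmin_glb_lt|].
  intros h Hh. assert (h1 := Rmin_l delta s). assert (h2 := Rmin_r delta s).
  assert (E0 := E (RtoC 0) ltac:(rewrite Cmod_0; lra)). rewrite Cplus_0_r in E0.
  rewrite <- E0, <- E by lra. apply H. lra.
Qed.

Lemma cderiv_linear (c z : C) : cderiv (fun w => c * w)%C z c.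
Proof.
  exists 0, 1. split; [lra|]. split; [lra|]. intros h _.
  replace (c * (z + h) - c * z - c * h)%C with (RtoC 0) by ring. rewrite Cmod_0. lra.
Qed.

Lemma cderiv_mult (F G : C -> C) (z dF dG : C) :
  cderiv F z dF -> cderiv G z dG ->
  cderiv (fun w => F w * G w)%C z (dF * G z + F z * dG)%C.
Proof.
  intros (M1 & d1 & HM1 & Hd1 & H1) (M2 & d2 & HM2 & Hd2 & H2).
  assert (hF := Cmod_ge_0 (F z)). assert (hG := Cmod_ge_0 (G z)).
  assert (hdF := Cmod_ge_0 dF). assert (hdG := Cmod_ge_0 dG).
  exists (M1 * (Cmod (G z) + Cmod dG + M2) + Cmod (F z) * M2 + Cmod dF * (Cmod dG + M2)),
    (Rmin 1 (Rmin d1 d2)).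
  split.
  { assert (0 <= M1 * (Cmod (G z) + Cmod dG + M2)) by (apply Rmult_le_pos; lra).
    assert (0 <= Cmod (F z) * M2) by (apply Rmult_le_pos; lra).
    assert (0 <= Cmod dF * (Cmod dG + M2)) by (apply Rmult_le_pos; lra). lra. }
  split; [now repeat apply Rmin_glb_lt; [lra| |]|].
  intros h Hh. assert (m1 := Rmin_l 1 (Rmin d1 d2)). assert (m2 := Rmin_r 1 (Rmin d1 d2)).
  assert (m3 := Rmin_l d1 d2). assert (m4 := Rmin_r d1 d2).
  specialize (H1 h ltac:(lra)). specialize (H2 h ltac:(lra)).
  set (rF := (F (z + h) - F z - dF * h)%C) in *. set (rG := (G (z + h) - G z - dG * h)%C) in *.
  replace (F (z + h) * G (z + h) - F z * G z - (dF * G z + F z * dG) * h)%C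
    with (rF * (G z + dG * h + rG) + (F z * rG + (dF * h) * (dG * h + rG)))%C
    by (unfold rF, rG; ring).
  set (t := Cmod h) in *. assert (ht : 0 <= t) by apply Cmod_ge_0.
  assert (t2 : 0 <= t ^ 2 <= t) by (split; nra).
  assert (k1 : Cmod (dG * h + rG)%C <= (Cmod dG + M2) * t).
  { eapply Rle_trans; [apply Cmod_triangle|]. rewrite Cmod_mult. fold t. nra. }
  assert (k2 : Cmod (G z + dG * h + rG)%C <= Cmod (G z) + Cmod dG + M2).
  { rewrite <- Cplus_assoc. eapply Rle_trans; [apply Cmod_triangle|].
    assert ((Cmod dG + M2) * t <= Cmod dG + M2) by nra. lra. }
  eapply Rle_trans; [apply Cmod_triangle|].
  assert (k3 : Cmod (rF * (G z + dG * h + rG))%C <= M1 * t ^ 2 * (Cmod (G z) + Cmod dG + M2)).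
  { rewrite Cmod_mult. apply Rmult_le_compat; try apply Cmod_ge_0; easy. }
  assert (k4 : Cmod (F z * rG + dF * h * (dG * h + rG))%C
     <= Cmod (F z) * (M2 * t ^ 2) + (Cmod dF * t) * ((Cmod dG + M2) * t)).
  { eapply Rle_trans; [apply Cmod_triangle|]. rewrite !Cmod_mult. fold t.
    apply Rplus_le_compat; apply Rmult_le_compat_l; try easy. now apply Rmult_le_pos. }
  eapply Rle_trans; [apply Rplus_le_compat; [apply k3|apply k4]|]. right. ring.
Qed.

Lemma cderiv_comp (F G : C -> C) (z dF dG : C) :
  cderiv F (G z) dF -> cderiv G z dG -> cderiv (fun w => F (G w)) z (dF * dG)%C.
Proof.
  intros (M1 & d1 & HM1 & Hd1 & H1) (M2 & d2 & HM2 & Hd2 & H2).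
  assert (hdF := Cmod_ge_0 dF). assert (hdG := Cmod_ge_0 dG).
  set (K := Cmod dG + M2).
  assert (HK : 0 <= K) by (unfold K; lra).
  exists (M1 * K ^ 2 + Cmod dF * M2), (Rmin 1 (Rmin d2 (d1 / (K + 1)))).
  assert (H0 : 0 < d1 / (K + 1)) by (apply Rdiv_lt_0_compat; lra).
  split.
  { assert (0 <= M1 * K ^ 2) by (apply Rmult_le_pos; [easy|now apply pow_le]).
    assert (0 <= Cmod dF * M2) by now apply Rmult_le_pos. lra. }
  split; [now repeat apply Rmin_glb_lt; [lra| |]|].
  intros h Hh.
  assert (m1 := Rmin_l 1 (Rmin d2 (d1 / (K + 1)))). assert (m2 := Rmin_r 1 (Rmin d2 (d1 / (K + 1)))).
  assert (m3 := Rmin_l d2 (d1 / (K + 1))). assert (m4 := Rmin_r d2 (d1 / (K + 1))).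
  specialize (H2 h ltac:(lra)).
  set (t := Cmod h) in *. assert (ht : 0 <= t) by apply Cmod_ge_0.
  set (rG := (G (z + h) - G z - dG * h)%C) in *. set (k := (dG * h + rG)%C).
  assert (t2 : 0 <= t ^ 2 <= t) by (split; nra).
  assert (Hk : Cmod k <= K * t).
  { unfold k, K. eapply Rle_trans; [apply Cmod_triangle|]. rewrite Cmod_mult. fold t. nra. }
  assert (HKt : K * t <= d1).
  { assert (Htd : t <= d1 / (K + 1)) by lra.
    apply (Rmult_le_compat_l (K + 1)) in Htd; [|lra].
    replace ((K + 1) * (d1 / (K + 1))) with d1 in Htd by (field; lra). lra. }
  specialize (H1 k ltac:(lra)).
  replace (G (z + h)%C) with (G z + k)%C by (unfold k, rG; ring).
  replace (F (G z + k) - F (G z) - dF * dG * h)%C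
    with ((F (G z + k) - F (G z) - dF * k) + dF * rG)%C by (unfold k; ring).
  eapply Rle_trans; [apply Cmod_triangle|]. rewrite Cmod_mult.
  assert (k3 : Cmod k ^ 2 <= (K * t) ^ 2) by (apply pow_incr; split; [apply Cmod_ge_0|easy]).
  apply (Rmult_le_compat_l M1) in k3; [|easy].
  apply (Rmult_le_compat_l (Cmod dF)) in H2; [|easy].
  replace ((M1 * K ^ 2 + Cmod dF * M2) * t ^ 2) with (M1 * (K * t) ^ 2 + Cmod dF * (M2 * t ^ 2)) by ring.
  lra.
Qed.

Lemma sin_Lipschitz (x : R) : Rabs (sin x) <= Rabs x.
Proof.
  assert (H := bounded_variation sin cos 1 0 x).
  rewrite sin_0, !Rminus_0_r in H. rewrite Rmult_1_l in H. apply H.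
  intros t _. split; [apply is_derive_Reals, derivable_pt_lim_sin|].
  apply Rabs_le. destruct (COS_bound t). lra.
Qed.

Lemma cos_minus_1_bound (x : R) : Rabs (cos x - 1) <= x ^ 2 / 2.
Proof.
  replace (cos x) with (1 - 2 * sin (x / 2) * sin (x / 2)).
  - assert (H := sin_Lipschitz (x / 2)).
    assert (H2 : Rabs (sin (x / 2)) * Rabs (sin (x / 2)) <= Rabs (x / 2) * Rabs (x / 2))
      by (apply Rmult_le_compat; auto using Rabs_pos).
    rewrite <- !Rabs_mult in H2.
    rewrite !Rabs_pos_eq in H2 by nra.
    apply Rabs_le. nra.
  - rewrite <- cos_2a_sin. f_equal. field.
Qed.

Lemma sin_minus_id_bound (x : R) : Rabs x <= 1 -> Rabs (sin x - x) <= x ^ 2.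
Proof.
  intros Hx.
  assert (H := bounded_variation (fun t => sin t - t) (fun t => cos t - 1) (Rabs x) 0 x).
  cbv beta in H. rewrite sin_0, !Rminus_0_r in H.
  rewrite <- Rabs_mult, (Rabs_pos_eq (x * x)) in H by nra.
  replace (x ^ 2) with (x * x) by ring. apply H.
  intros t Ht. rewrite Rminus_0_r in Ht. split.
  - apply is_derive_Reals.
    apply (derivable_pt_lim_minus sin id t (cos t) 1);
      [apply derivable_pt_lim_sin|apply derivable_pt_lim_id].
  - eapply Rle_trans; [apply cos_minus_1_bound|].
    assert (h := Rabs_pos t). rewrite <- (pow2_abs t). nra.
Qed.

Lemma exp_quadratic (x : R) : Rabs x <= 1 / 2 -> Rabs (exp x - 1 - x) <= 2 * x ^ 2.
Proof.
  intros Hx. apply Rabs_le_between in Hx.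
  assert (H1 := exp_ineq1_le x). assert (H2 := exp_ineq1_le (- x)).
  rewrite exp_Ropp in H2. assert (Hp := exp_pos x).
  assert (H3 : exp x * (1 - x) <= 1).
  { apply (Rmult_le_compat_l (exp x)) in H2; [|lra]. rewrite Rinv_r in H2 by lra. lra. }
  apply Rabs_le. split; [nra|]. nra.
Qed.

Lemma cderiv_Cexp (z : C) : cderiv Cexp z (Cexp z).
Proof.
  exists (Cmod (Cexp z) * 8), (1 / 2).
  split; [apply Rmult_le_pos; [apply Cmod_ge_0|lra]|]. split; [lra|].
  intros h Hh. rewrite Cexp_plus.
  replace (Cexp z * Cexp h - Cexp z - Cexp z * h)%C with (Cexp z * (Cexp h - 1 - h))%C by ring.
  rewrite Cmod_mult, Rmult_assoc. apply Rmult_le_compat_l; [apply Cmod_ge_0|].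
  assert (hx := re_le_Cmod h). assert (hy := im_le_Cmod h).
  eapply Rle_trans; [apply Cmod_le_Re_Im|]. rewrite Cmod2_alt.
  destruct h as [x y]. unfold Cexp, Cminus, Cplus, Copp, RtoC. cbn [Re Im fst snd] in *.
  assert (H1 := exp_quadratic x ltac:(lra)). assert (H2 := cos_minus_1_bound y).
  assert (H3 := sin_minus_id_bound y ltac:(lra)).
  assert (Hx : Rabs x <= 1 / 2) by lra. apply Rabs_le_between in Hx.
  assert (He : 0 < exp x <= 2).
  { split; [apply exp_pos|]. apply Rabs_le_between in H1. nra. }
  assert (He1 : Rabs (exp x - 1) <= 2 * Rabs x).
  { replace (exp x - 1) with ((exp x - 1 - x) + x) by ring.
    eapply Rle_trans; [apply Rabs_triang|].
    rewrite <- (pow2_abs x) in H1. assert (h := Rabs_pos x). nra. }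
  assert (A1 : Rabs (exp x * cos y + -(1) + - x) <= 2 * x ^ 2 + y ^ 2).
  { replace (exp x * cos y + -(1) + - x) with ((exp x - 1 - x) + exp x * (cos y - 1)) by ring.
    eapply Rle_trans; [apply Rabs_triang|]. rewrite Rabs_mult, (Rabs_pos_eq (exp x)) by lra.
    assert (h := Rabs_pos (cos y - 1)). nra. }
  assert (A2 : Rabs (exp x * sin y + - 0 + - y) <= 2 * y ^ 2 + (x ^ 2 + y ^ 2)).
  { replace (exp x * sin y + - 0 + - y) with (exp x * (sin y - y) + (exp x - 1) * y) by ring.
    eapply Rle_trans; [apply Rabs_triang|]. rewrite !Rabs_mult, (Rabs_pos_eq (exp x)) by lra.
    assert (h := Rabs_pos (sin y - y)).
    assert (h2 := Rabs_pos y). assert (h3 := Rabs_pos x).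
    rewrite <- (pow2_abs x), <- (pow2_abs y) in *.
    assert (Rabs (exp x - 1) * Rabs y <= 2 * Rabs x * Rabs y) by (apply Rmult_le_compat_r; lra).
    assert (exp x * Rabs (sin y - y) <= 2 * Rabs y ^ 2) by (apply Rmult_le_compat; lra).
    assert (0 <= (Rabs x - Rabs y) ^ 2) by apply pow2_ge_0. lra. }
  assert (0 <= x ^ 2) by nra. assert (0 <= y ^ 2) by nra. lra.
Qed.

(** Along a radius, questions about complex derivatives become questions about
    two real functions of one real variable. *)
Lemma cderiv_ray (F : C -> C) (v d : C) (t : R) :
  cderiv F (t * v)%C d ->
  is_derive (fun s : R => Re (F (s * v)%C)) t (Re (d * v)%C) /\
  is_derive (fun s : R => Im (F (s * v)%C)) t (Im (d * v)%C).
Proof.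
  intros (M & delta & HM & Hdelta & H).
  assert (Hv := Cmod_ge_0 v).
  assert (Hk : forall eps, 0 < eps -> exists del : posreal, forall h, h <> 0 -> Rabs h < del ->
    Cmod ((F ((t + h)%R * v) - F (t * v)) / h - d * v)%C < eps).
  { intros eps Heps.
    assert (Hp : 0 < Rmin (delta / (Cmod v + 1)) (eps / (M * Cmod v ^ 2 + 1))).
    { assert (0 <= M * Cmod v ^ 2) by (apply Rmult_le_pos; [easy|now apply pow_le]).
      apply Rmin_glb_lt; apply Rdiv_lt_0_compat; lra. }
    exists (mkposreal _ Hp). intros h Hh0 Hh. cbn [pos] in Hh.
    assert (h1 := Rmin_l (delta / (Cmod v + 1)) (eps / (M * Cmod v ^ 2 + 1))).
    assert (h2 := Rmin_r (delta / (Cmod v + 1)) (eps / (M * Cmod v ^ 2 + 1))).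
    assert (Hhp : 0 < Rabs h) by now apply Rabs_pos_lt.
    assert (Hhc : RtoC h <> RtoC 0) by (intros E; apply RtoC_inj in E; lra).
    assert (Hhv : Cmod (h * v)%C = Rabs h * Cmod v) by (now rewrite Cmod_mult, Cmod_R).
    assert (Hs : Cmod (h * v)%C <= delta).
    { rewrite Hhv. assert (Hb : Rabs h <= delta / (Cmod v + 1)) by lra.
      apply (Rmult_le_compat_r (Cmod v + 1)) in Hb; [|lra].
      replace (delta / (Cmod v + 1) * (Cmod v + 1)) with delta in Hb by (field; lra). nra. }
    specialize (H _ Hs). rewrite Hhv in H.
    replace (t * v + h * v)%C with ((t + h)%R * v)%C in H by (rewrite RtoC_plus; ring).
    replace ((F ((t + h)%R * v) - F (t * v)) / h - d * v)%C
      with ((F ((t + h)%R * v) - F (t * v) - d * (h * v)) / h)%C by (field; easy).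
    rewrite Cmod_div, Cmod_R by easy.
    apply Rle_lt_trans with (M * Cmod v ^ 2 * Rabs h).
    - apply Rmult_le_reg_r with (Rabs h); [easy|].
      unfold Rdiv. rewrite Rmult_assoc, Rinv_l by lra. lra.
    - assert (Hq : 0 <= M * Cmod v ^ 2) by (apply Rmult_le_pos; [easy|now apply pow_le]).
      assert (Hb : Rabs h < eps / (M * Cmod v ^ 2 + 1)) by lra.
      apply (Rmult_lt_compat_r (M * Cmod v ^ 2 + 1)) in Hb; [|lra].
      replace (eps / (M * Cmod v ^ 2 + 1) * (M * Cmod v ^ 2 + 1)) with eps in Hb by (field; lra).
      lra. }
  assert (Hdiv : forall (w : C) (h : R), h <> 0 ->
    Re (w / h)%C = Re w / h /\ Im (w / h)%C = Im w / h).
  { intros [x y] h Hh. unfold Cdiv. rewrite <- RtoC_inv by easy.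
    unfold Cmult, RtoC; simpl. split; field; easy. }
  split; apply is_derive_Reals; intros eps Heps; destruct (Hk eps Heps) as [del Hdel];
    exists del; intros h Hh0 Hh; specialize (Hdel h Hh0 Hh);
    destruct (Hdiv (F ((t + h)%R * v) - F (t * v))%C h Hh0) as [E1 E2].
  - eapply Rle_lt_trans; [|apply Hdel]. eapply Rle_trans; [|apply re_le_Cmod].
    right. apply f_equal. symmetry.
    change (Re ((F ((t + h)%R * v) - F (t * v)) / h)%C - Re (d * v)%C
      = (Re (F ((t + h)%R * v)%C) - Re (F (t * v)%C)) / h - Re (d * v)%C).
    now rewrite E1.
  - eapply Rle_lt_trans; [|apply Hdel]. eapply Rle_trans; [|apply im_le_Cmod].
    right. apply f_equal. symmetry.
    change (Im ((F ((t + h)%R * v) - F (t * v)) / h)%C - Im (d * v)%C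
      = (Im (F ((t + h)%R * v)%C) - Im (F (t * v)%C)) / h - Im (d * v)%C).
    now rewrite E2.
Qed.

Lemma in_disc_ray (v : C) (t : R) : in_disc v -> 0 <= t <= 1 -> in_disc (t * v)%C.
Proof.
  unfold in_disc. intros Hv Ht. rewrite Cmod_mult, Cmod_R, Rabs_pos_eq by lra.
  assert (h := Cmod_ge_0 v). nra.
Qed.

Lemma cderiv_zero_constant (F : C -> C) (v : C) :
  (forall z, in_disc z -> cderiv F z 0) -> in_disc v -> F v = F (RtoC 0).
Proof.
  intros H Hv.
  assert (E : forall t, 0 <= t <= 1 ->
    is_derive (fun s : R => Re (F (s * v)%C)) t 0 /\
    is_derive (fun s : R => Im (F (s * v)%C)) t 0).
  { intros t Ht. assert (h := cderiv_ray F v _ t (H _ (in_disc_ray v t Hv Ht))).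
    rewrite Cmult_0_l in h. exact h. }
  assert (R1 := eq_is_derive (V := R_NormedModule) (fun s : R => Re (F (s * v)%C)) 0 1 (fun t Ht => proj1 (E t Ht)) ltac:(lra)).
  assert (R2 := eq_is_derive (V := R_NormedModule) (fun s : R => Im (F (s * v)%C)) 0 1 (fun t Ht => proj2 (E t Ht)) ltac:(lra)).
  cbv beta in R1, R2. rewrite Cmult_0_l, Cmult_1_l in R1, R2.
  destruct (F v), (F (RtoC 0)). simpl in R1, R2. congruence.
Qed.

(** The logarithmic derivative in terms of the branch [L]: for [z <> 0] it says
    [z f' / f = 1 + z L'], where [s = z L'] is the sum of the series with
    coefficients [k l_k]. *)
Lemma C_derive_z_exp (f L : C -> C) (l : nat -> C) (z : C) :
  unit_series l L -> (forall w, in_disc w -> f w = (w * Cexp (L w))%C) -> in_disc z ->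
  exists s, has_sum (fun k => INR k * l k * z ^ k)%C s /\
    C_derive f z = (Cexp (L z) * (1 + s))%C.
Proof.
  intros HL Hf Hz.
  destruct (unit_series_cderiv l L z HL Hz) as (d & Hd & Hs).
  exists (z * d)%C. split.
  - apply has_sum_ext with (2 := has_sum_scal z _ _ Hs).
    intros [|k]; [simpl; ring|]. simpl pred. rewrite Cpow_S. ring.
  - apply cderiv_C_derive.
    apply cderiv_ext_loc with (F := fun w => (1 * w * Cexp (L w))%C); [|].
    + exists ((1 - Cmod z) / 2). unfold in_disc in Hz. split; [lra|].
      intros h Hh. rewrite Hf; [ring|]. unfold in_disc.
      eapply Rle_lt_trans; [apply Cmod_triangle|]. lra.
    + assert (H := cderiv_mult _ _ z _ _ (cderiv_linear 1 z)
        (cderiv_comp Cexp L z _ _ (cderiv_Cexp (L z)) Hd)).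
      replace (Cexp (L z) * (1 + z * d))%C
        with (1 * Cexp (L z) + 1 * z * (Cexp (L z) * d))%C by ring.
      exact H.
Qed.

(** * Uniform limits of polynomials on a disc *)

Definition is_poly (p : C -> C) : Prop :=
  exists N a, forall z, p z = poly_eval a N z.

(** The disc algebra of the disc of radius [r]. *)
Definition poly_limit (r : R) (F : C -> C) : Prop :=
  forall eps, 0 < eps ->
  exists p, is_poly p /\ forall z, Cmod z <= r -> Cmod (F z - p z)%C <= eps.

Lemma is_poly_const (c : C) : is_poly (fun _ => c).
Proof.
  exists 1%nat, (fun _ => c). intros z. unfold poly_eval. simpl. ring.
Qed.

Lemma poly_eval_cat (a b : nat -> C) (m n : nat) (z : C) :
  poly_eval (fun k => if (k <? m)%nat then a k else b (k - m)%nat) (m + n) z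
  = (poly_eval a m z + z ^ m * poly_eval b n z)%C.
Proof.
  unfold poly_eval. rewrite csum_add. f_equal.
  - apply csum_ext. intros k Hk. apply Nat.ltb_lt in Hk. now rewrite Hk.
  - rewrite <- csum_scal. apply csum_ext. intros k _.
    replace (m + k <? m)%nat with false by (symmetry; apply Nat.ltb_ge; lia).
    replace (m + k - m)%nat with k by lia. rewrite Cpow_add_r. ring.
Qed.

Lemma is_poly_plus (p q : C -> C) :
  is_poly p -> is_poly q -> is_poly (fun z => p z + q z)%C.
Proof.
  intros (M & a & Hp) (N & b & Hq).
  assert (Hpad : forall c m n z,
    poly_eval c m z = poly_eval (fun k => if (k <? m)%nat then c k else RtoC 0) (m + n) z).
  { intros c m n z. rewrite (poly_eval_cat c (fun _ => RtoC 0)).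
    replace (poly_eval (fun _ => RtoC 0) n z) with (RtoC 0); [ring|].
    unfold poly_eval. rewrite csum_ext with (b := fun _ => RtoC 0) by (intros; ring).
    now rewrite csum_zero. }
  exists (M + N)%nat, (fun k => (if (k <? M)%nat then a k else RtoC 0)
    + (if (k <? N)%nat then b k else RtoC 0))%C.
  intros z. rewrite Hp, Hq, (Hpad a M N), (Hpad b N M), (Nat.add_comm N M).
  unfold poly_eval. rewrite <- csum_plus. apply csum_ext. intros; ring.
Qed.

Lemma is_poly_monomial_mult (m : nat) (q : C -> C) :
  is_poly q -> is_poly (fun z => z ^ m * q z)%C.
Proof.
  intros (N & b & Hq).
  exists (m + N)%nat, (fun k => if (k <? m)%nat then RtoC 0 else b (k - m)%nat).
  intros z. rewrite (poly_eval_cat (fun _ => RtoC 0)), Hq.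
  replace (poly_eval (fun _ => RtoC 0) m z) with (RtoC 0); [ring|].
  unfold poly_eval. rewrite csum_ext with (b := fun _ => RtoC 0) by (intros; ring).
  now rewrite csum_zero.
Qed.

Lemma is_poly_ext (p q : C -> C) : (forall z, p z = q z) -> is_poly p -> is_poly q.
Proof.
  intros E (N & a & H). exists N, a. intros z. now rewrite <- E.
Qed.

Lemma is_poly_scal (c : C) (q : C -> C) : is_poly q -> is_poly (fun z => c * q z)%C.
Proof.
  intros (N & b & Hq). exists N, (fun k => c * b k)%C. intros z. rewrite Hq.
  unfold poly_eval. rewrite <- csum_scal. apply csum_ext. intros; ring.
Qed.

Lemma is_poly_mult (p q : C -> C) :
  is_poly p -> is_poly q -> is_poly (fun z => p z * q z)%C.
Proof.
  intros (M & a & Hp) Hq.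
  apply is_poly_ext with (fun z => poly_eval a M z * q z)%C; [intros; now rewrite Hp|].
  clear p Hp. induction M as [|M IH].
  - apply is_poly_ext with (fun _ => RtoC 0); [|apply is_poly_const].
    intros. unfold poly_eval. simpl. ring.
  - apply is_poly_ext with
      (fun z => poly_eval a M z * q z + a M * (z ^ M * q z))%C.
    + intros z. unfold poly_eval. simpl. ring.
    + now apply is_poly_plus, is_poly_scal, is_poly_monomial_mult.
Qed.

Lemma poly_eval_bound (a : nat -> C) (n : nat) (r : R) (z : C) :
  Cmod z <= r -> Cmod (poly_eval a n z) <= rsum (fun k => Cmod (a k) * r ^ k) n.
Proof.
  intros Hz. apply csum_bound. intros k _. rewrite Cmod_mult, Cmod_pow.
  apply Rmult_le_compat_l; [apply Cmod_ge_0|]. apply pow_incr. split; [apply Cmod_ge_0|easy].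
Qed.

Lemma poly_limit_bounded (r : R) (F : C -> C) :
  0 <= r -> poly_limit r F -> exists K, 0 <= K /\ forall z, Cmod z <= r -> Cmod (F z) <= K.
Proof.
  intros Hr HF. destruct (HF 1 ltac:(lra)) as (p & (N & a & Hp) & H).
  set (S0 := rsum (fun k => Cmod (a k) * r ^ k) N).
  assert (HS : 0 <= S0).
  { apply rsum_nonneg. intros. apply Rmult_le_pos; [apply Cmod_ge_0|now apply pow_le]. }
  exists (S0 + 1). split; [lra|]. intros z Hz.
  specialize (H z Hz). assert (Hb := poly_eval_bound a N r z Hz). rewrite <- Hp in Hb.
  replace (F z) with ((F z - p z) + p z)%C by ring.
  eapply Rle_trans; [apply Cmod_triangle|]. fold S0 in Hb. lra.
Qed.

Lemma poly_limit_poly (r : R) (p : C -> C) : is_poly p -> poly_limit r p.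
Proof.
  intros Hp eps Heps. exists p. split; [easy|]. intros z _.
  replace (p z - p z)%C with (RtoC 0) by ring. rewrite Cmod_0. lra.
Qed.

Lemma poly_limit_plus (r : R) (F G : C -> C) :
  poly_limit r F -> poly_limit r G -> poly_limit r (fun z => F z + G z)%C.
Proof.
  intros HF HG eps Heps.
  destruct (HF (eps / 2) ltac:(lra)) as (p & Hp & H1).
  destruct (HG (eps / 2) ltac:(lra)) as (q & Hq & H2).
  exists (fun z => p z + q z)%C. split; [now apply is_poly_plus|].
  intros z Hz. specialize (H1 z Hz). specialize (H2 z Hz).
  replace (F z + G z - (p z + q z))%C with ((F z - p z) + (G z - q z))%C by ring.
  eapply Rle_trans; [apply Cmod_triangle|]. lra.
Qed.

Lemma poly_limit_mult (r : R) (F G : C -> C) :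
  0 <= r -> poly_limit r F -> poly_limit r G -> poly_limit r (fun z => F z * G z)%C.
Proof.
  intros Hr HF HG eps Heps.
  destruct (poly_limit_bounded r F Hr HF) as (K & HK & HKb).
  destruct (poly_limit_bounded r G Hr HG) as (L & HL & HLb).
  set (e := Rmin 1 (eps / (K + L + 1))).
  assert (He : 0 < e).
  { apply Rmin_glb_lt; [lra|]. apply Rdiv_lt_0_compat; lra. }
  assert (He1 : e <= 1) by apply Rmin_l.
  assert (He2 : e * (K + L + 1) <= eps).
  { assert (H := Rmin_r 1 (eps / (K + L + 1))). fold e in H.
    apply (Rmult_le_compat_r (K + L + 1)) in H; [|lra].
    replace (eps / (K + L + 1) * (K + L + 1)) with eps in H by (field; lra). lra. }
  destruct (HF e He) as (p & Hp & H1). destruct (HG e He) as (q & Hq & H2).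
  exists (fun z => p z * q z)%C. split; [now apply is_poly_mult|].
  intros z Hz. specialize (H1 z Hz). specialize (H2 z Hz).
  specialize (HKb z Hz). specialize (HLb z Hz).
  replace (F z * G z - p z * q z)%C with
    (F z * (G z - q z) + (F z - p z) * (G z + - (G z - q z)))%C by ring.
  eapply Rle_trans; [apply Cmod_triangle|]. rewrite !Cmod_mult.
  assert (H3 : Cmod (G z + - (G z - q z))%C <= L + 1).
  { eapply Rle_trans; [apply Cmod_triangle|]. rewrite Cmod_opp. lra. }
  assert (h1 := Cmod_ge_0 (F z)). assert (h2 := Cmod_ge_0 (G z - q z)%C).
  assert (h3 := Cmod_ge_0 (F z - p z)%C). assert (h4 := Cmod_ge_0 (G z + - (G z - q z))%C).
  apply Rle_trans with (K * e + e * (L + 1)); [|nra].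
  apply Rplus_le_compat; apply Rmult_le_compat; easy.
Qed.

Lemma poly_limit_ext (r : R) (F G : C -> C) :
  (forall z, Cmod z <= r -> F z = G z) -> poly_limit r F -> poly_limit r G.
Proof.
  intros E H eps Heps. destruct (H eps Heps) as (p & Hp & H1).
  exists p. split; [easy|]. intros z Hz. rewrite <- E; auto.
Qed.

Lemma unit_series_poly_limit (a : nat -> C) (F : C -> C) (r : R) :
  unit_series a F -> 0 <= r < 1 -> poly_limit r F.
Proof.
  intros HF Hr eps Heps.
  assert (Hs := unit_series_abs a F r HF Hr).
  assert (Hpos : forall k, 0 <= Cmod (a k) * r ^ k).
  { intros. apply Rmult_le_pos; [apply Cmod_ge_0|apply pow_le; lra]. }
  destruct (series_tail_small _ Hpos Hs eps Heps) as [N HN].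
  exists (poly_eval a N). split; [now exists N, a|].
  intros z Hz. unfold poly_eval. apply has_sum_tail_bound; [apply HF; unfold in_disc; lra|].
  intros n. eapply Rle_trans; [|apply (HN N n (le_n _))].
  apply rsum_le. intros k _. rewrite Cmod_mult, Cmod_pow.
  apply Rmult_le_compat_l; [apply Cmod_ge_0|]. apply pow_incr. split; [apply Cmod_ge_0|easy].
Qed.

(** For a large constant [c] the values of [1 - u / c] lie in a disc of radius
    [kappa < 1], because [u] is bounded and stays in the half plane
    [Re u >= 1/2]; so the Neumann series of
    [1 / u = (1 / c) / (1 - (1 - u / c))] converges uniformly. *)
Lemma poly_limit_inv (r : R) (u : C -> C) :
  0 <= r -> poly_limit r u -> (forall z, Cmod z <= r -> 1 / 2 <= Re (u z)) ->
  poly_limit r (fun z => / u z)%C.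
Proof.
  intros Hr Hu Hre.
  destruct (poly_limit_bounded r u Hr Hu) as (K & HK & HKb).
  (* [|1 - u / c|^2 = 1 - 2 Re u / c + |u|^2 / c^2 <= 1 - 1 / c + K^2 / c^2],
     and this [c] makes the last term at most [1 / (2 c)] *)
  set (c := 2 * (K ^ 2 + 1)).
  assert (Hc : 2 <= c) by (unfold c; nra).
  set (e := fun z => (1 + - / RtoC c * u z)%C).
  set (kappa := sqrt (1 - / (2 * c))).
  assert (Hinv : 0 < / (2 * c) <= 1 / 4).
  { split; [apply Rinv_0_lt_compat; lra|].
    apply Rmult_le_reg_r with (2 * c); [lra|]. rewrite Rinv_l by lra. lra. }
  assert (Hk : 0 <= kappa < 1).
  { unfold kappa. split; [apply sqrt_pos|]. rewrite <- sqrt_1 at 2. apply sqrt_lt_1; lra. }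
  assert (Hk2 : kappa ^ 2 = 1 - / (2 * c)).
  { unfold kappa. rewrite <- Rsqr_pow2. apply Rsqr_sqrt. lra. }
  assert (Hcc : RtoC c <> RtoC 0) by (intros E; apply RtoC_inj in E; lra).
  assert (He : forall z, Cmod z <= r -> Cmod (e z) <= kappa).
  { intros z Hz. apply Rsqr_incr_0; [|apply Cmod_ge_0|lra]. rewrite !Rsqr_pow2, Hk2.
    specialize (Hre z Hz). specialize (HKb z Hz).
    assert (HK2 : Cmod (u z) ^ 2 <= K ^ 2) by (apply pow_incr; split; [apply Cmod_ge_0|easy]).
    unfold e. rewrite <- RtoC_inv by lra. rewrite Cmod2_alt in *.
    destruct (u z) as [x y]. unfold Cplus, Cmult, Copp, RtoC in *. cbn [Re Im fst snd] in *.
    assert (Hi : / (2 * c) = / c / 2) by (field; lra). rewrite Hi in *.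
    set (i := / c) in *.
    assert (Hci : c * i = 1) by (unfold i; field; lra).
    assert (Hki : 2 * (K ^ 2 + 1) * i = 1) by exact Hci.
    assert (Hi0 : 0 < i) by lra.
    replace (_ + _) with (1 - 2 * x * i + (x ^ 2 + y ^ 2) * i * i) by ring.
    assert ((x ^ 2 + y ^ 2) * i * i <= K ^ 2 * i * i).
    { apply Rmult_le_compat_r; [lra|]. apply Rmult_le_compat_r; lra. }
    assert (K ^ 2 * i * i <= i / 2) by nra.
    nra. }
  assert (Hunz : forall z, Cmod z <= r -> u z <> RtoC 0).
  { intros z Hz E. specialize (Hre z Hz). rewrite E in Hre. simpl in Hre. lra. }
  assert (Hinvb : forall z, Cmod z <= r -> Cmod (/ u z)%C <= 2).
  { intros z Hz. rewrite Cmod_inv by now apply Hunz.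
    assert (Hb : 1 / 2 <= Cmod (u z)).
    { eapply Rle_trans; [apply (Hre z Hz)|]. eapply Rle_trans; [apply Rle_abs|apply re_le_Cmod]. }
    apply Rmult_le_reg_r with (Cmod (u z)); [lra|]. rewrite Rinv_l; lra. }
  assert (Hpe : poly_limit r e).
  { apply poly_limit_plus; [apply poly_limit_poly, is_poly_const|].
    apply poly_limit_mult; [easy| |easy]. apply poly_limit_poly, is_poly_const. }
  assert (Hpow : forall M, poly_limit r (fun z => e z ^ M)%C).
  { induction M as [|M IH]; [apply poly_limit_poly, (is_poly_const 1)|].
    apply poly_limit_mult with (F := e); easy. }
  assert (Hsum : forall M, poly_limit r (fun z => / c * csum (fun m => e z ^ m) M)%C).
  { intros M. apply poly_limit_mult; [easy|apply poly_limit_poly, is_poly_const|].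
    induction M as [|M IH]; [apply poly_limit_poly, (is_poly_const 0)|].
    apply poly_limit_plus with (G := fun z => (e z ^ M)%C); [exact IH|apply Hpow]. }
  intros eps Heps.
  destruct (pow_lt_1_zero kappa) with (y := eps / 4) as [M HM];
    [rewrite Rabs_pos_eq; lra|lra|].
  specialize (HM M (le_n _)). rewrite Rabs_pos_eq in HM by (apply pow_le; lra).
  destruct (Hsum M (eps / 2) ltac:(lra)) as (p & Hp & H1).
  exists p. split; [easy|]. intros z Hz. specialize (H1 z Hz).
  set (s := csum (fun m => e z ^ m)%C M) in *.
  assert (Hg : (/ c * s = / u z - e z ^ M * / u z)%C).
  { assert (G := geometric_csum (e z) M). fold s in G.
    replace (1 - e z)%C with (/ c * u z)%C in G by (unfold e; ring).
    assert (Hu0 := Hunz z Hz).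
    replace (/ c * s)%C with (/ u z * (/ c * u z * s))%C by (field; easy).
    rewrite G. ring. }
  replace (/ u z - p z)%C with (e z ^ M * / u z + (/ c * s - p z))%C by (rewrite Hg; ring).
  eapply Rle_trans; [apply Cmod_triangle|].
  rewrite Cmod_mult, Cmod_pow.
  assert (Hpm : Cmod (e z) ^ M <= kappa ^ M).
  { apply pow_incr. split; [apply Cmod_ge_0|now apply He]. }
  assert (h1 := Hinvb z Hz). assert (h2 := Cmod_ge_0 (/ u z)%C).
  assert (h3 : 0 <= Cmod (e z) ^ M) by (apply pow_le, Cmod_ge_0).
  nra.
Qed.

(** * Clunie's inequality *)

(** Once [K] is replaced by a nearby polynomial, Parseval's identity holds for
    both sides on enough roots of unity to separate all powers; the terms of
    order at least [m] only increase the mean of the left side. *)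
Lemma circle_domination (r : R) (b p : nat -> C) (m n : nat) (K : C -> C) :
  0 <= r <= 1 -> poly_limit r K ->
  (forall z, Cmod z = r -> Cmod (poly_eval b m z + z ^ m * K z)%C <= Cmod (poly_eval p n z)) ->
  rsum (fun k => Cmod (b k) ^ 2 * r ^ (2 * k)) m
  <= rsum (fun k => Cmod (p k) ^ 2 * r ^ (2 * k)) n.
Proof.
  intros Hr HK Hdom.
  set (lhs := rsum _ m). set (rhs := rsum _ n).
  set (S0 := rsum (fun k => Cmod (p k) * r ^ k) n).
  assert (HS : 0 <= S0).
  { apply rsum_nonneg. intros. apply Rmult_le_pos; [apply Cmod_ge_0|apply pow_le; lra]. }
  assert (Heps : forall eps, 0 < eps <= 1 -> lhs <= rhs + eps * (2 * S0 + 1)).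
  { intros eps He.
    destruct (HK eps ltac:(lra)) as (q & (M & a & Hq) & Hap).
    set (d := fun k => if (k <? m)%nat then b k else a (k - m)%nat).
    set (N := (m + M + n + 1)%nat).
    assert (HN : 0 < INR N) by (apply lt_0_INR; unfold N; lia).
    assert (Hle : rsum (fun j => Cmod (poly_eval d (m + M) (circle_pt r N j)) ^ 2) N
      <= rsum (fun j => Cmod (poly_eval p n (circle_pt r N j)) ^ 2 + eps * (2 * S0 + 1)) N).
    { apply rsum_le. intros j _. set (z := circle_pt r N j).
      assert (Hz : Cmod z = r) by (apply Cmod_circle_pt; lra).
      specialize (Hdom z Hz). specialize (Hap z ltac:(lra)). rewrite Hq in Hap.
      unfold d. rewrite poly_eval_cat.
      assert (Hb : Cmod (poly_eval b m z + z ^ m * poly_eval a M z)%C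
                   <= Cmod (poly_eval p n z) + eps).
      { replace (_ + _)%C with ((poly_eval b m z + z ^ m * K z)
          + - (z ^ m * (K z - poly_eval a M z)))%C by ring.
        eapply Rle_trans; [apply Cmod_triangle|].
        rewrite Cmod_opp, Cmod_mult, Cmod_pow, Hz.
        assert (0 <= r ^ m <= 1).
        { split; [apply pow_le; lra|]. rewrite <- (pow1 m). apply pow_incr. lra. }
        assert (h := Cmod_ge_0 (K z - poly_eval a M z)%C). nra. }
      assert (HP := poly_eval_bound p n r z ltac:(lra)). fold S0 in HP.
      assert (h1 := Cmod_ge_0 (poly_eval b m z + z ^ m * poly_eval a M z)%C).
      assert (h2 := Cmod_ge_0 (poly_eval p n z)).
      nra. }
    rewrite rsum_plus, rsum_const in Hle.
    rewrite (circle_parseval r N (m + M) d), (circle_parseval r N n p) in Hle;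
      [|lra|unfold N; lia|lra|unfold N; lia].
    fold rhs in Hle.
    assert (Hld : lhs <= rsum (fun k => Cmod (d k) ^ 2 * r ^ (2 * k)) (m + M)).
    { apply Rle_trans with (rsum (fun k => Cmod (d k) ^ 2 * r ^ (2 * k)) m).
      - right. apply rsum_ext. intros k Hk. unfold d. apply Nat.ltb_lt in Hk. now rewrite Hk.
      - apply rsum_incr; [|lia]. intros k.
        apply Rmult_le_pos; apply pow_le; [apply Cmod_ge_0|lra]. }
    apply Rmult_le_reg_l with (INR N); [easy|].
    apply (Rmult_le_compat_l (INR N)) in Hld; lra. }
  apply Rnot_lt_le. intros Hlt.
  set (eps := Rmin 1 ((lhs - rhs) / (2 * (2 * S0 + 1)))).
  assert (H0 : 0 < eps) by (apply Rmin_glb_lt; [lra|apply Rdiv_lt_0_compat; lra]).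
  assert (H1 : eps <= 1) by apply Rmin_l.
  assert (H2 : eps <= (lhs - rhs) / (2 * (2 * S0 + 1))) by apply Rmin_r.
  apply (Rmult_le_compat_r (2 * S0 + 1)) in H2; [|lra].
  replace ((lhs - rhs) / (2 * (2 * S0 + 1)) * (2 * S0 + 1)) with ((lhs - rhs) / 2) in H2
    by (field; lra).
  specialize (Heps eps ltac:(lra)). lra.
Qed.

(** Bernoulli's inequality gives [r ^ (2 k) >= 1 - 2 m (1 - r)] for [k < m], so
    the sum at radius [r] is close to the sum at radius 1, uniformly. *)
Lemma rsum_radius_one (x : nat -> R) (m : nat) (Y : R) :
  (forall k, 0 <= x k) ->
  (forall r, 0 < r < 1 -> rsum (fun k => x k * r ^ (2 * k)) m <= Y) ->
  rsum x m <= Y.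
Proof.
  intros Hx H. apply Rnot_lt_le. intros Hlt.
  set (s := rsum x m) in *.
  assert (Hs : 0 <= s) by now apply rsum_nonneg.
  set (D := 2 * INR m * s + 1 + (s - Y)).
  assert (HD : 0 < D).
  { unfold D. assert (h := pos_INR m). assert (0 <= INR m * s) by now apply Rmult_le_pos. lra. }
  set (t := (s - Y) / (2 * D)).
  assert (Ht : 0 < t) by (apply Rdiv_lt_0_compat; lra).
  assert (HtD : 2 * t * D = s - Y) by (unfold t; field; lra).
  assert (hm := pos_INR m). assert (hms : 0 <= INR m * s) by now apply Rmult_le_pos.
  assert (Ht1 : t < 1) by (unfold D in *; nra).
  specialize (H (1 - t) ltac:(lra)).
  assert (Hl : (1 - 2 * INR m * t) * s <= rsum (fun k => x k * (1 - t) ^ (2 * k)) m).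
  { unfold s. rewrite <- rsum_scal. apply rsum_le. intros k Hk.
    assert (Hb : 1 + INR (2 * k) * - t <= (1 + - t) ^ (2 * k)).
    { clear - Ht1. generalize (2 * k)%nat. induction n as [|n IH]; [simpl; lra|].
      rewrite S_INR. change ((1 + - t) ^ S n) with ((1 + - t) * (1 + - t) ^ n).
      assert (hn := pos_INR n). nra. }
    rewrite mult_INR in Hb. replace (INR 2) with 2 in Hb by (simpl; lra).
    apply lt_INR in Hk. specialize (Hx k).
    replace (1 - t) with (1 + - t) by ring. rewrite Rmult_comm.
    apply Rmult_le_compat_l; [easy|].
    assert (INR k * t <= INR m * t) by (apply Rmult_le_compat_r; lra). lra. }
  unfold D in *. nra.
Qed.

(** Clunie's device.  Put [phi = q / (1 - B q)], a Schwarz function, and let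
    [Q_m] be the partial sum of [q] up to [z ^ (m - 1)].  Since
    [q = phi (1 - B q)],
    [phi (1 - B Q_n) = Q_(n+1) + (q - Q_(n+1)) + B phi (q - Q_n)],
    whose last two terms are divisible by [z ^ (n+1)]; and [|phi| <= 1], so the
    left side is dominated by [1 - B Q_n] on every circle. *)
Lemma clunie_step (c : nat -> C) (q : C -> C) (B : R) (n : nat) :
  unit_series c q -> c O = RtoC 0 -> -1 <= B <= 1 ->
  (forall z, in_disc z -> Cmod (q z) <= Cmod (1 - B * q z)%C) ->
  rsum (fun k => Cmod (c k) ^ 2) (S n) <= 1 + B ^ 2 * rsum (fun k => Cmod (c k) ^ 2) n.
Proof.
  intros Hq Hc0 HB Hdom.
  destruct n as [|n].
  { simpl. rewrite Hc0, Cmod_0. lra. }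
  set (tail := fun m z => CSeries (fun k => c (m + k)%nat * z ^ k)%C).
  assert (Htail : forall m r, 0 < r < 1 ->
    forall z, Cmod z <= r -> has_sum (fun k => c (m + k)%nat * z ^ k)%C (tail m z)).
  { intros m r Hr z Hz.
    apply has_sum_dominated with (b := fun k => / r ^ m * (Cmod (c (m + k)%nat) * r ^ (m + k))).
    - intros k. rewrite Cmod_mult, Cmod_pow, pow_add.
      assert (0 < r ^ m) by (apply pow_lt; lra).
      replace (/ r ^ m * (Cmod (c (m + k)%nat) * (r ^ m * r ^ k)))
        with (Cmod (c (m + k)%nat) * r ^ k) by (field; lra).
      apply Rmult_le_compat_l; [apply Cmod_ge_0|]. apply pow_incr. split; [apply Cmod_ge_0|easy].
    - apply (@ex_series_scal R_AbsRing R_NormedModule (/ r ^ m)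
        (fun k => Cmod (c (m + k)%nat) * r ^ (m + k))).
      apply (ex_series_incr_n (fun k => Cmod (c k) * r ^ k) m).
      apply (unit_series_abs c q r Hq). lra. }
  assert (Htail_unit : forall m, unit_series (fun k => c (m + k)%nat) (tail m)).
  { intros m z Hz. unfold in_disc in Hz. assert (h := Cmod_ge_0 z).
    apply (Htail m ((Cmod z + 1) / 2)); lra. }
  assert (Hsplit : forall m z, in_disc z -> q z = (poly_eval c m z + z ^ m * tail m z)%C).
  { intros m z Hz.
    assert (H1 := proj1 (has_sum_drop _ _ m) (Hq z Hz)).
    assert (H2 := has_sum_scal (z ^ m) _ _ (Htail_unit m z Hz)).
    assert (E : (q z - poly_eval c m z = z ^ m * tail m z)%C).
    { apply (has_sum_unique _ _ _ H1). apply has_sum_ext with (2 := H2).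
      intros k. rewrite Cpow_add_r. ring. }
    rewrite <- E. ring. }
  set (u := fun z => (1 - B * q z)%C).
  assert (Hre : forall z, in_disc z -> 1 / 2 <= Re (u z)).
  { intros z Hz. specialize (Hdom z Hz).
    assert (H2 : Cmod (q z) ^ 2 <= Cmod (1 - B * q z)%C ^ 2)
      by (apply pow_incr; split; [apply Cmod_ge_0|easy]).
    rewrite !Cmod2_alt in H2. unfold u.
    destruct (q z) as [x y]. unfold Cminus, Cplus, Cmult, Copp, RtoC in *.
    cbn [Re Im fst snd] in *.
    assert (B ^ 2 <= 1) by nra.
    assert (B ^ 2 * (x ^ 2 + y ^ 2) <= x ^ 2 + y ^ 2) by nra.
    nra. }
  assert (Hunz : forall z, in_disc z -> u z <> RtoC 0).
  { intros z Hz E. specialize (Hre z Hz). rewrite E in Hre. simpl in Hre. lra. }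
  set (m := S n).
  (* the coefficients of [1 - B Q_n]: the constant one is 1 because [c 0 = 0] *)
  set (p := fun k => match k with O => RtoC 1 | S _ => (- B * c k)%C end).
  assert (Hp : forall z, poly_eval p m z = (1 - B * poly_eval c m z)%C).
  { intros z. unfold poly_eval, m. rewrite !csum_shift, Hc0.
    rewrite (csum_ext (fun k => p (S k) * z ^ S k)%C (fun k => - B * (c (S k) * z ^ S k))%C)
      by (intros; unfold p; ring).
    rewrite csum_scal. simpl. ring. }
  assert (Hrhs : rsum (fun k => Cmod (p k) ^ 2) m = 1 + B ^ 2 * rsum (fun k => Cmod (c k) ^ 2) m).
  { unfold m. rewrite !rsum_shift, Hc0, <- (Rmult_1_r 1) at 1.
    rewrite (rsum_ext (fun k => Cmod (p (S k)) ^ 2) (fun k => B ^ 2 * Cmod (c (S k)) ^ 2)).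
    - rewrite rsum_scal. unfold p. rewrite Cmod_0, Cmod_1. ring.
    - intros k _. unfold p. rewrite Cmod_mult, <- RtoC_opp, Cmod_R, Rabs_Ropp, Rpow_mult_distr.
      now rewrite pow2_abs. }
  apply rsum_radius_one; [intros; apply pow_le, Cmod_ge_0|].
  intros r Hr.
  apply Rle_trans with (rsum (fun k => Cmod (p k) ^ 2 * r ^ (2 * k)) m).
  2:{ rewrite <- Hrhs. apply rsum_le. intros k _.
      rewrite <- (Rmult_1_r (Cmod (p k) ^ 2)) at 2.
      apply Rmult_le_compat_l; [apply pow_le, Cmod_ge_0|].
      rewrite <- (pow1 (2 * k)). apply pow_incr. lra. }
  assert (Hlim : forall j, poly_limit r (tail j)).
  { intros j. apply unit_series_poly_limit with (fun k => c (j + k)%nat); [apply Htail_unit|lra]. }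
  assert (Hin : forall z, Cmod z <= r -> in_disc z) by (intros z Hz; unfold in_disc; lra).
  apply circle_domination with
    (K := fun z => (tail (S m) z + B * (tail 1%nat z * / u z * tail m z))%C); [lra| |].
  - assert (Hui : poly_limit r (fun z => / u z)%C).
    { apply poly_limit_inv; [lra| |intros; apply Hre; auto].
      apply poly_limit_ext with (fun z => 1 + - B * q z)%C; [intros; unfold u; ring|].
      apply poly_limit_plus; [apply poly_limit_poly, is_poly_const|].
      apply poly_limit_mult; [lra|apply poly_limit_poly, is_poly_const|].
      apply unit_series_poly_limit with c; [easy|lra]. }
    apply poly_limit_plus; [easy|].
    apply poly_limit_mult; [lra|apply poly_limit_poly, is_poly_const|].
    apply poly_limit_mult; [lra| |easy]. now apply poly_limit_mult; [lra| |].
  - intros z Hz. assert (Hd : in_disc z) by (unfold in_disc; lra).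
    assert (E : (poly_eval c (S m) z
        + z ^ S m * (tail (S m) z + B * (tail 1%nat z * / u z * tail m z))
        = q z * / u z * poly_eval p m z)%C).
    { rewrite Hp.
      assert (E1 : (z ^ m * tail m z = q z - poly_eval c m z)%C) by (rewrite (Hsplit m z Hd); ring).
      assert (E2 : (z ^ S m * tail (S m) z = q z - poly_eval c (S m) z)%C)
        by (rewrite (Hsplit (S m) z Hd); ring).
      assert (E3 : (z * tail 1%nat z = q z)%C).
      { rewrite (Hsplit 1%nat z Hd). unfold poly_eval. simpl. rewrite Hc0. ring. }
      transitivity (poly_eval c (S m) z + z ^ S m * tail (S m) z
        + B * ((z * tail 1%nat z) * / u z * (z ^ m * tail m z)))%C.
      { rewrite (Cpow_S z m). ring. }
      rewrite E1, E2, E3. generalize (Hunz z Hd). unfold u. intros Hz0. field. exact Hz0. }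
    rewrite E, !Cmod_mult, Cmod_inv by now apply Hunz.
    assert (Hu0 : 0 < Cmod (u z)) by now apply Cmod_gt_0, Hunz.
    assert (Hle : Cmod (q z) * / Cmod (u z) <= 1).
    { apply Rmult_le_reg_r with (Cmod (u z)); [easy|].
      rewrite Rmult_assoc, Rinv_l by lra. specialize (Hdom z Hd). unfold u. lra. }
    assert (h := Cmod_ge_0 (poly_eval p m z)). nra.
Qed.

(** * The bounds on the logarithmic coefficients *)

Lemma bounded_ex_series (a : nat -> R) (M : R) :
  (forall k, 0 <= a k) -> (forall n, rsum a n <= M) -> ex_series a /\ Series a <= M.
Proof.
  intros Ha Hb.
  destruct (ex_finite_lim_seq_incr (sum_n a) M) as [l Hl].
  - intros n. rewrite !sum_n_rsum. apply rsum_incr; [easy|lia].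
  - intros n. rewrite sum_n_rsum. apply Hb.
  - assert (Hs : is_series a l) by exact Hl.
    split; [now exists l|]. rewrite (is_series_unique a l Hs).
    apply (is_lim_seq_le (sum_n a) (fun _ => M) l M); [|exact Hl|apply is_lim_seq_const].
    intros n. rewrite sum_n_rsum. apply Hb.
Qed.

Lemma Li2_ex_series (x : R) :
  0 <= x <= 1 -> ex_series (fun k => x ^ S k / INR (S k) ^ 2).
Proof.
  intros Hx.
  apply (bounded_ex_series _ 2).
  - intros k. apply Rdiv_le_0_compat; [now apply pow_le|]. apply pow_lt, lt_0_INR. lia.
  - intros n. destruct n as [|n]; [simpl; lra|].
    (* [1 / (b + 1)^2 <= 1 / b - 1 / (b + 1)] makes the bound telescope *)
    apply Rle_trans with (2 - / INR (S n)).
    + induction n as [|n IH].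
      * simpl. lra.
      * change (rsum ?a (S (S n))) with (rsum a (S n) + a (S n)). cbv beta.
        set (b := INR (S n)) in *.
        assert (Hb : 1 <= b) by (unfold b; rewrite S_INR; assert (h := pos_INR n); lra).
        rewrite (S_INR (S n)). fold b.
        assert (Hp : 0 <= x ^ S (S n) <= 1).
        { split; [now apply pow_le|]. rewrite <- (pow1 (S (S n))). now apply pow_incr. }
        assert (H1 : x ^ S (S n) / (b + 1) ^ 2 <= / b - / (b + 1)).
        { apply Rle_trans with (1 / (b + 1) ^ 2).
          - apply Rmult_le_compat_r; [|easy]. left. apply Rinv_0_lt_compat, pow_lt. lra.
          - replace (/ b - / (b + 1)) with (1 / (b * (b + 1))) by (field; lra).
            apply Rmult_le_compat_l; [lra|]. apply Rinv_le_contravar; nra. }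
        lra.
    + assert (0 < / INR (S n)) by (apply Rinv_0_lt_compat, lt_0_INR; lia). lra.
Qed.

(** Summation by parts.  The induction needs the stronger claim that the
    difference of the weighted sums is at least the last weight times the
    difference of the plain sums. *)
Lemma abel_majorization (w s t : nat -> R) (n : nat) :
  (forall k, 0 <= w (S k) <= w k) -> (forall m, rsum s m <= rsum t m) ->
  rsum (fun k => w k * s k) n <= rsum (fun k => w k * t k) n.
Proof.
  intros Hw Hst. destruct n as [|n]; [simpl; lra|].
  assert (H : w n * (rsum t (S n) - rsum s (S n))
    <= rsum (fun k => w k * t k) (S n) - rsum (fun k => w k * s k) (S n)).
  { induction n as [|n IH]; [simpl; lra|].
    change (rsum ?a (S (S n))) with (rsum a (S n) + a (S n)).
    specialize (Hst (S n)). specialize (Hw n). cbv beta. nra. }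
  assert (Hwn : 0 <= w n) by (specialize (Hw n); lra).
  specialize (Hst (S n)). nra.
Qed.

(** The recursion [S_(n+1) <= 1 + B^2 S_n] of [clunie_step] is satisfied with
    equality by the geometric sums on the right, which are the partial sums for
    [q = w / (1 + B w)]. *)
Lemma clunie_partial_sums (c : nat -> C) (q : C -> C) (B : R) :
  unit_series c q -> c O = RtoC 0 -> -1 <= B <= 1 ->
  (forall z, in_disc z -> Cmod (q z) <= Cmod (1 - B * q z)%C) ->
  forall n, rsum (fun k => Cmod (c (S k)) ^ 2) n <= rsum (fun k => (B ^ 2) ^ k) n.
Proof.
  intros Hq Hc0 HB Hdom.
  assert (E : forall n, rsum (fun k => Cmod (c (S k)) ^ 2) n = rsum (fun k => Cmod (c k) ^ 2) (S n)).
  { intros n. rewrite rsum_shift, Hc0, Cmod_0. ring. }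
  induction n as [|n IH]; [simpl; lra|].
  rewrite E. eapply Rle_trans; [apply (clunie_step c q B (S n)); auto|].
  rewrite <- E, rsum_shift.
  rewrite (rsum_ext (fun k => (B ^ 2) ^ S k) (fun k => B ^ 2 * (B ^ 2) ^ k)) by (intros; reflexivity).
  rewrite rsum_scal. apply Rplus_le_compat_l, Rmult_le_compat_l; [apply pow2_ge_0|exact IH].
Qed.

Lemma clunie_coeff_bound (c : nat -> C) (q : C -> C) (B : R) (n : nat) :
  unit_series c q -> c O = RtoC 0 -> -1 <= B <= 1 ->
  (forall z, in_disc z -> Cmod (q z) <= Cmod (1 - B * q z)%C) ->
  Cmod (c n) <= 1.
Proof.
  intros Hq Hc0 HB Hdom.
  assert (H := clunie_step c q B n Hq Hc0 HB Hdom). simpl rsum in H.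
  assert (0 <= rsum (fun k => Cmod (c k) ^ 2) n)
    by (apply rsum_nonneg; intros; apply pow_le, Cmod_ge_0).
  assert (B ^ 2 <= 1) by nra.
  set (s := rsum _ n) in *.
  assert (B ^ 2 * s <= 1 * s) by (apply Rmult_le_compat_r; easy).
  apply Rnot_lt_le. intros Hgt. nra.
Qed.

Lemma Cexp_neq_0 (z : C) : Cexp z <> RtoC 0.
Proof.
  apply Cmod_gt_0. rewrite Cmod_Cexp. apply exp_pos.
Qed.

Lemma Re_1_plus_pos (u : C) : in_disc u -> 0 < Re (1 + u)%C.
Proof.
  unfold in_disc. intros Hu. assert (h := re_le_Cmod u).
  change (Re (1 + u)%C) with (1 + Re u). assert (h2 := Rle_abs (- Re u)).
  rewrite Rabs_Ropp in h2. lra.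
Qed.

Lemma one_plus_neq_0 (u : C) : in_disc u -> (1 + u)%C <> RtoC 0.
Proof.
  intros Hu E. assert (H := Re_1_plus_pos u Hu). rewrite E in H. simpl in H. lra.
Qed.

Lemma in_disc_scaled (B : R) (w : C) : -1 <= B <= 1 -> in_disc w -> in_disc (B * w).
Proof.
  unfold in_disc. intros HB Hw. rewrite Cmod_mult, Cmod_R.
  assert (Rabs B <= 1) by now apply Rabs_le.
  assert (h := Cmod_ge_0 w). assert (h2 := Rabs_pos B). nra.
Qed.

(** The normalised function [q = (p - 1) / (A - B)] with [p = z f' / f] has the
    coefficients [2 k gamma_k / (A - B)], and being subordinate to
    [w / (1 + B w)] means [|q| <= |1 - B q|]. *)
Lemma starlike_log_series (A B : R) (f : C -> C) (gamma : nat -> C) :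
  -1 <= B -> B < A -> A <= 1 -> starlike_class A B f -> log_coeffs f gamma ->
  exists c q, unit_series c q /\ c O = RtoC 0 /\
    (forall k, c (S k) = (2 * INR (S k) / (A - B) * gamma (S k))%C) /\
    forall z, in_disc z -> Cmod (q z) <= Cmod (1 - B * q z)%C.
Proof.
  intros hB hBA hA [[_ [Hf0 _]] [_ (p & _ & Hp & phi & _ & Hphi0 & Hphi)]]
    (L & (_ & _ & HLexp) & HLser).
  assert (HAB : RtoC (A - B) <> RtoC 0) by (intros E; apply RtoC_inj in E; lra).
  set (l := fun k => match k with O => RtoC 0 | S _ => (2 * gamma k)%C end).
  assert (HL : unit_series l L).
  { intros z Hz. apply (has_sum_drop _ _ 1%nat).
    replace (L z - csum (fun k => l k * z ^ k) 1)%C with (L z) by (simpl; ring).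
    apply has_sum_ext with (fun k => 2 * (gamma (S k) * z ^ S k))%C.
    - intros k. simpl. ring.
    - apply has_sum_is_series. now apply HLser. }
  assert (Hf : forall w, in_disc w -> f w = (w * Cexp (L w))%C).
  { intros w Hw. destruct (Ceq_dec w 0) as [->|Hw0]; [rewrite Hf0; ring|].
    rewrite (HLexp w Hw Hw0). field. exact Hw0. }
  set (c := fun k => (INR k * l k / (A - B)%R)%C).
  set (q := fun z => ((p z - 1) / (A - B)%R)%C).
  assert (Hp0 : p (RtoC 0) = RtoC 1).
  { destruct (Hphi (RtoC 0)) as [_ E]; [unfold in_disc; rewrite Cmod_0; lra|].
    rewrite E, Hphi0. field. }
  exists c, q. split; [|split; [|split]].
  - intros z Hz. destruct (C_derive_z_exp f L l z HL Hf Hz) as (s & Hs & Hd).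
    assert (Es : (p z - 1)%C = s).
    { destruct (Ceq_dec z 0) as [->|Hz0].
      - rewrite Hp0, (has_sum_unique _ _ _ Hs (has_sum_at_0 _)). simpl. ring.
      - rewrite (Hp z Hz Hz0), Hd, (Hf z Hz). field.
        split; [apply Cexp_neq_0|exact Hz0]. }
    unfold q. rewrite Es.
    replace (s / (A - B)%R)%C with (/ (A - B)%R * s)%C by (field; exact HAB).
    apply has_sum_ext with (2 := has_sum_scal (/ (A - B)%R) _ _ Hs).
    intros k. unfold c. field. exact HAB.
  - unfold c, l. simpl. field. exact HAB.
  - intros k. unfold c, l. rewrite RtoC_minus. field. rewrite <- RtoC_minus. exact HAB.
  - intros z Hz. destruct (Hphi z Hz) as [Hw E]. set (w := phi z) in *.
    assert (Hden := one_plus_neq_0 _ (in_disc_scaled B w ltac:(lra) Hw)).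
    assert (Eq : q z = (w / (1 + B * w))%C).
    { unfold q. rewrite E. rewrite RtoC_minus in *. field. now split. }
    assert (E1 : (1 - B * q z)%C = (1 / (1 + B * w))%C) by (rewrite Eq; field; exact Hden).
    rewrite E1, Eq, !Cmod_div, Cmod_1 by exact Hden.
    apply Rmult_le_compat_r; [|lra].
    left. apply Rinv_0_lt_compat. now apply Cmod_gt_0.
Qed.

Lemma starlike_log_coeff_bounds (A B : R) (f : C -> C) (gamma : nat -> C) :
  -1 <= B -> B < A -> A <= 1 -> B <> 0 -> starlike_class A B f -> log_coeffs f gamma ->
  (forall n : nat, (1 <= n)%nat -> Cmod (gamma n) <= (A - B) / (2 * INR n)) /\
  ex_series (fun k : nat => Cmod (gamma (S k)) ^ 2) /\
  Series (fun k : nat => Cmod (gamma (S k)) ^ 2) <= ((A - B) / (2 * B)) ^ 2 * Li2 (B ^ 2).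
Proof.
  intros hB hBA hA hB0 Hf Hg.
  destruct (starlike_log_series A B f gamma hB hBA hA Hf Hg) as (c & q & Hq & Hc0 & Hc & Hdom).
  assert (HB : -1 <= B <= 1) by lra.
  assert (Hmod : forall k, Cmod (gamma (S k)) = (A - B) / (2 * INR (S k)) * Cmod (c (S k))).
  { intros k. assert (Hk : 0 < INR (S k)) by (apply lt_0_INR; lia).
    rewrite Hc. rewrite <- RtoC_minus, <- RtoC_mult, <- RtoC_div by lra.
    rewrite Cmod_mult, Cmod_R, Rabs_pos_eq; [field; lra|].
    apply Rdiv_le_0_compat; lra. }
  split.
  { intros [|n] Hn; [lia|]. rewrite Hmod.
    assert (Hk : 0 < INR (S n)) by (apply lt_0_INR; lia).
    assert (H1 := clunie_coeff_bound c q B (S n) Hq Hc0 HB Hdom).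
    rewrite <- (Rmult_1_r ((A - B) / (2 * INR (S n)))) at 2.
    apply Rmult_le_compat_l; [|exact H1]. apply Rdiv_le_0_compat; lra. }
  apply bounded_ex_series; [intros; apply pow_le, Cmod_ge_0|].
  intros n.
  set (w := fun k => / INR (S k) ^ 2).
  assert (Hw : forall k, 0 <= w (S k) <= w k).
  { intros k. unfold w. assert (Hk : 0 < INR (S k)) by (apply lt_0_INR; lia).
    assert (Hk2 : INR (S k) <= INR (S (S k))) by (apply le_INR; lia).
    split; [left; apply Rinv_0_lt_compat, pow_lt; lra|].
    apply Rinv_le_contravar; [now apply pow_lt|]. apply pow_incr. lra. }
  assert (Hab := abel_majorization w _ _ n Hw (clunie_partial_sums c q B Hq Hc0 HB Hdom)).
  apply Rle_trans with (((A - B) / 2) ^ 2 * rsum (fun k => w k * (B ^ 2) ^ k) n).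
  - rewrite (rsum_ext _ (fun k => ((A - B) / 2) ^ 2 * (w k * Cmod (c (S k)) ^ 2))).
    + rewrite rsum_scal. apply Rmult_le_compat_l; [apply pow2_ge_0|exact Hab].
    + intros k _. rewrite Hmod. unfold w. field. apply not_0_INR. lia.
  - replace (((A - B) / (2 * B)) ^ 2 * Li2 (B ^ 2))
      with (((A - B) / 2) ^ 2 * (/ B ^ 2 * Li2 (B ^ 2))) by (field; lra).
    apply Rmult_le_compat_l; [apply pow2_ge_0|].
    assert (HB2 : 0 < B ^ 2 <= 1) by nra.
    rewrite (rsum_ext _ (fun k => / B ^ 2 * ((B ^ 2) ^ S k / INR (S k) ^ 2))).
    + rewrite rsum_scal. apply Rmult_le_compat_l; [left; now apply Rinv_0_lt_compat|].
      apply rsum_le_Series; [|apply Li2_ex_series; lra].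
      intros k. apply Rdiv_le_0_compat; [apply pow_le; lra|]. apply pow_lt, lt_0_INR. lia.
    + intros k _. unfold w. change ((B ^ 2) ^ S k) with (B ^ 2 * (B ^ 2) ^ k).
      field. split; [apply not_0_INR; lia|lra].
Qed.

(** * The logarithmic and the binomial series *)

Definition power_sum (a : nat -> C) (z : C) : C := CSeries (fun k => a k * z ^ k)%C.

Lemma power_sum_unit_series (a : nat -> C) :
  (forall r, 0 <= r < 1 -> ex_series (fun k => Cmod (a k) * r ^ k)) ->
  unit_series a (power_sum a).
Proof.
  intros H z Hz. apply has_sum_dominated with (fun k => Cmod (a k) * Cmod z ^ k).
  - intros k. rewrite Cmod_mult, Cmod_pow. lra.
  - apply H. split; [apply Cmod_ge_0|exact Hz].
Qed.

Lemma unit_series_at_0 (a : nat -> C) (F : C -> C) : unit_series a F -> F (RtoC 0) = a O.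
Proof.
  intros H. apply (has_sum_unique (fun k => a k * 0 ^ k)%C); [|apply has_sum_at_0].
  apply H. unfold in_disc. rewrite Cmod_0. lra.
Qed.

Lemma has_sum_geometric (v : C) : Cmod v < 1 -> has_sum (fun k => v ^ k)%C (/ (1 - v))%C.
Proof.
  intros Hv eps Heps.
  assert (Hne : (1 - v)%C <> RtoC 0).
  { apply Cminus_eq_contra. intros E. rewrite <- E, Cmod_1 in Hv. lra. }
  assert (Hp : 0 < Cmod (1 - v)%C) by now apply Cmod_gt_0.
  destruct (pow_lt_1_zero (Cmod v)) with (y := eps * Cmod (1 - v)%C) as [N HN];
    [rewrite Rabs_pos_eq; [easy|apply Cmod_ge_0]|now apply Rmult_lt_0_compat|].
  exists N. intros n Hn. specialize (HN n Hn).
  rewrite Rabs_pos_eq in HN by apply pow_le, Cmod_ge_0.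
  replace (csum (fun k => v ^ k) n - / (1 - v))%C with (- (v ^ n / (1 - v)))%C.
  - rewrite Cmod_opp, Cmod_div, Cmod_pow by easy.
    apply Rmult_lt_reg_r with (Cmod (1 - v)%C); [easy|].
    unfold Rdiv. rewrite Rmult_assoc, Rinv_l by lra. lra.
  - assert (G := geometric_csum v n).
    replace (csum (fun k => v ^ k) n)%C with ((1 - v ^ n) / (1 - v))%C;
      [field; easy|]. rewrite <- G. field. easy.
Qed.

(** The Taylor coefficients of [log (1 + u)]. *)
Definition log_coeff (k : nat) : C :=
  match k with O => RtoC 0 | S j => RtoC ((-1) ^ j / INR (S j)) end.

Lemma log_unit_series : unit_series log_coeff (power_sum log_coeff).
Proof.
  apply power_sum_unit_series. intros r Hr.
  apply (@ex_series_le R_AbsRing R_CompleteNormedModule) with (fun k => r ^ k).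
  - intros k. change (norm ?x) with (Rabs x).
    assert (0 <= r ^ k) by (apply pow_le; lra).
    rewrite Rabs_mult, !Rabs_pos_eq by (easy || apply Cmod_ge_0).
    rewrite <- (Rmult_1_l (r ^ k)) at 2. apply Rmult_le_compat_r; [easy|].
    destruct k as [|k]; unfold log_coeff; [rewrite Cmod_0; lra|].
    rewrite Cmod_R. unfold Rdiv. rewrite Rabs_mult, pow_1_abs, Rmult_1_l.
    assert (1 <= INR (S k)) by (rewrite S_INR; assert (h := pos_INR k); lra).
    rewrite Rabs_pos_eq by (left; apply Rinv_0_lt_compat; lra).
    rewrite <- Rinv_1. apply Rinv_le_contravar; lra.
  - apply ex_series_geom. rewrite Rabs_pos_eq; lra.
Qed.

Lemma RtoC_neg1_pow (j : nat) (u : C) : (RtoC ((-1) ^ j) * u ^ j)%C = ((- u) ^ j)%C.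
Proof.
  rewrite RtoC_pow, <- Cpow_mult_l. f_equal. ring.
Qed.

Lemma log_series_cderiv (u : C) :
  in_disc u -> cderiv (power_sum log_coeff) u (/ (1 + u))%C.
Proof.
  intros Hu.
  destruct (unit_series_cderiv _ _ u log_unit_series Hu) as (d & Hd & Hs).
  replace (/ (1 + u))%C with d; [exact Hd|].
  apply (has_sum_drop _ _ 1%nat) in Hs.
  assert (Hg := has_sum_geometric (- u)%C ltac:(rewrite Cmod_opp; exact Hu)).
  replace (1 - - u)%C with (1 + u)%C in Hg by ring.
  apply (has_sum_unique (fun k => (- u) ^ k)%C); [|exact Hg].
  replace d with (d - csum (fun k => INR k * log_coeff k * u ^ pred k) 1)%C
    by (simpl; ring).
  apply has_sum_ext with (2 := Hs). intros k. cbn [Nat.add pred log_coeff].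
  rewrite <- RtoC_neg1_pow, <- RtoC_mult. do 2 f_equal. field. apply not_0_INR. lia.
Qed.

Lemma Carg_right_half_plane (w : C) : 0 < Re w -> Carg w = atan (Im w / Re w).
Proof.
  destruct w as [x y]. unfold Carg. cbn [Re Im fst snd]. intros Hx.
  set (th := atan (y / x)).
  assert (Hcos : x / Cmod (x, y) = cos th).
  { unfold th. rewrite cos_atan. unfold Cmod. cbn [fst snd].
    replace (x ^ 2 + y ^ 2) with (x ^ 2 * (1 + (y / x)²)) by (unfold Rsqr; field; lra).
    assert (H1 : 0 < 1 + (y / x)²) by (assert (h := Rle_0_sqr (y / x)); lra).
    rewrite sqrt_mult by (try apply pow2_ge_0; lra).
    rewrite <- Rsqr_pow2 at 1. rewrite sqrt_Rsqr by lra.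
    assert (H2 := sqrt_lt_R0 _ H1). field. lra. }
  rewrite Hcos. assert (Hb := atan_bound (y / x)). fold th in Hb.
  destruct (Rle_dec 0 y) as [Hy|Hy].
  - apply acos_cos.
    assert (0 <= th); [|lra].
    unfold th. rewrite <- atan_0.
    destruct (Rle_lt_or_eq_dec 0 (y / x)) as [h|h];
      [apply Rdiv_le_0_compat; lra|left; now apply atan_increasing|right; now rewrite <- h].
  - rewrite <- (cos_neg th), acos_cos; [ring|].
    assert (th < 0); [|lra].
    unfold th. rewrite <- atan_0. apply atan_increasing.
    unfold Rdiv. assert (0 < / x) by now apply Rinv_0_lt_compat. nra.
Qed.

(** Both sides vanish at [0] and have the same derivative along every radius;
    in the right half plane the principal argument is an arctangent. *)
Lemma Clog_series (v : C) : in_disc v -> Clog (1 + v) = power_sum log_coeff v.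
Proof.
  intros Hv. set (S := power_sum log_coeff).
  destruct v as [x y] eqn:Ev. rewrite <- Ev in *.
  assert (Hpos : forall t, 0 <= t <= 1 -> 0 < 1 + t * x).
  { intros t Ht. assert (H := Re_1_plus_pos _ (in_disc_ray v t Hv Ht)).
    rewrite Ev in H. unfold Cplus, Cmult, RtoC in H. simpl in H. lra. }
  assert (HS : forall t, 0 <= t <= 1 ->
    let n := (1 + t * x) ^ 2 + (t * y) ^ 2 in
    is_derive (fun s : R => Re (S (s * v)%C)) t ((x * (1 + t * x) + t * y ^ 2) / n) /\
    is_derive (fun s : R => Im (S (s * v)%C)) t (y / n)).
  { intros t Ht n.
    assert (H := cderiv_ray S v _ t (log_series_cderiv _ (in_disc_ray v t Hv Ht))).
    assert (Hn : 0 < n) by (unfold n; assert (h := Hpos t Ht); nra).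
    assert (E : (/ (1 + t * v) * v)%C = ((x * (1 + t * x) + t * y ^ 2) / n, y / n)).
    { rewrite Ev. unfold Cinv, Cplus, Cmult, RtoC. cbn [fst snd].
      apply injective_projections; cbn [fst snd]; unfold n; field;
      apply Rgt_not_eq; (eapply Rlt_le_trans; [exact Hn|unfold n; right; ring]). }
    rewrite E in H. exact H. }
  assert (H0 : S (RtoC 0) = RtoC 0) by exact (unit_series_at_0 _ _ log_unit_series).
  set (g1 := fun t : R => Re (S (t * v)%C) - / 2 * ln ((1 + t * x) ^ 2 + (t * y) ^ 2)).
  set (g2 := fun t : R => Im (S (t * v)%C) - atan (t * y / (1 + t * x))).
  assert (E1 : g1 0 = g1 1).
  { apply (eq_is_derive (V := R_NormedModule)); [|lra]. intros t Ht.
    destruct (HS t Ht) as [H _]. assert (h := Hpos t Ht).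
    assert (H2 : is_derive (fun t => / 2 * ln ((1 + t * x) ^ 2 + (t * y) ^ 2)) t
      ((x * (1 + t * x) + t * y ^ 2) / ((1 + t * x) ^ 2 + (t * y) ^ 2))).
    { auto_derive; [nra|]. field. nra. }
    assert (H3 := is_derive_minus (V := R_NormedModule) _ _ t _ _ H H2).
    rewrite minus_eq_zero in H3. exact H3. }
  assert (E2 : g2 0 = g2 1).
  { apply (eq_is_derive (V := R_NormedModule)); [|lra]. intros t Ht.
    destruct (HS t Ht) as [_ H]. assert (h := Hpos t Ht).
    assert (H2 : is_derive (fun t => atan (t * y / (1 + t * x))) t
      (y / ((1 + t * x) ^ 2 + (t * y) ^ 2))).
    { auto_derive; [lra|]. unfold Rsqr. field. repeat split; nra. }
    assert (H3 := is_derive_minus (V := R_NormedModule) _ _ t _ _ H H2).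
    rewrite minus_eq_zero in H3. exact H3. }
  unfold g1, g2 in E1, E2.
  rewrite Cmult_0_l, Cmult_1_l, H0 in E1, E2.
  rewrite !Rmult_0_l, !Rmult_1_l in E1, E2.
  replace ((1 + 0) ^ 2 + 0 ^ 2) with 1 in E1 by ring.
  rewrite ln_1 in E1. replace (0 / (1 + 0)) with 0 in E2 by field. rewrite atan_0 in E2.
  unfold Clog. rewrite Carg_right_half_plane by now apply Re_1_plus_pos.
  assert (h := Hpos 1 ltac:(lra)). rewrite Rmult_1_l in h.
  assert (Eln : ln (Cmod (1 + v)%C) = / 2 * ln ((1 + x) ^ 2 + y ^ 2)).
  { assert (Hc : 0 < Cmod (1 + v)%C).
    { now apply Cmod_gt_0, one_plus_neq_0. }
    assert (Esq : (1 + x) ^ 2 + y ^ 2 = Cmod (1 + v)%C ^ 2).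
    { rewrite Cmod2_alt, Ev. simpl. ring. }
    rewrite Esq. change (Cmod (1 + v)%C ^ 2) with (Cmod (1 + v)%C * (Cmod (1 + v)%C * 1)).
    rewrite Rmult_1_r, ln_mult by easy. field. }
  rewrite Eln.
  assert (Ei : Im (1 + v)%C / Re (1 + v)%C = y / (1 + x)).
  { rewrite Ev. simpl. f_equal. ring. }
  rewrite Ei. change (Re (RtoC 0)) with 0 in E1. change (Im (RtoC 0)) with 0 in E2.
  apply injective_projections; cbn [fst snd]; unfold Re, Im in E1, E2; lra.
Qed.

Fixpoint binomial_coeff (alpha : R) (k : nat) : R :=
  match k with
  | O => 1
  | S j => binomial_coeff alpha j * (alpha - INR j) / INR (S j)
  end.

(** A ratio test: consecutive coefficients have a ratio of modulus at most
    [1 + |alpha| / (k + 1)], which tends to 1. *)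
Lemma binomial_unit_series (alpha : R) :
  unit_series (fun k => RtoC (binomial_coeff alpha k))
    (power_sum (fun k => RtoC (binomial_coeff alpha k))).
Proof.
  apply power_sum_unit_series. intros r Hr.
  (* beyond this index the ratio times [r] is at most [s = (1 + r) / 2] *)
  destruct (nfloor_ex (2 * Rabs alpha / (1 - r))) as [N HN].
  { assert (h := Rabs_pos alpha). apply Rdiv_le_0_compat; lra. }
  set (M := S N). set (s := (1 + r) / 2).
  apply (ex_series_incr_n _ M).
  apply (@ex_series_le R_AbsRing R_CompleteNormedModule) with
    (fun k => Rabs (binomial_coeff alpha M) * r ^ M * s ^ k).
  - intros k. change (norm ?x) with (Rabs x).
    rewrite Cmod_R, Rabs_mult, Rabs_Rabsolu, (Rabs_pos_eq (r ^ _)) by (apply pow_le; lra).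
    induction k as [|k IH]; [rewrite Nat.add_0_r; simpl; lra|].
    rewrite Nat.add_succ_r. set (j := (M + k)%nat) in *.
    change (binomial_coeff alpha (S j)) with (binomial_coeff alpha j * (alpha - INR j) / INR (S j)).
    assert (Hj : 0 < INR (S j)) by (apply lt_0_INR; lia).
    unfold Rdiv. rewrite !Rabs_mult, (Rabs_pos_eq (/ _)) by (left; now apply Rinv_0_lt_compat).
    assert (Hratio : Rabs (alpha - INR j) * / INR (S j) * r <= s).
    { apply Rmult_le_reg_r with (INR (S j)); [easy|].
      replace (Rabs (alpha - INR j) * / INR (S j) * r * INR (S j))
        with (Rabs (alpha - INR j) * r) by (field; lra).
      assert (Ht : Rabs (alpha - INR j) <= Rabs alpha + INR j).
      { unfold Rminus. eapply Rle_trans; [apply Rabs_triang|].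
        rewrite Rabs_Ropp, (Rabs_pos_eq (INR j)) by apply pos_INR. lra. }
      assert (HNj : INR N + 1 <= INR j).
      { rewrite <- S_INR. apply le_INR. unfold j, M. lia. }
      rewrite S_INR. unfold s.
      assert (Ha : 2 * Rabs alpha <= INR j * (1 - r)).
      { assert (Hd : 2 * Rabs alpha / (1 - r) <= INR j) by lra.
        apply (Rmult_le_compat_r (1 - r)) in Hd; [|lra].
        replace (2 * Rabs alpha / (1 - r) * (1 - r)) with (2 * Rabs alpha) in Hd by (field; lra).
        exact Hd. }
      assert (h := Rabs_pos alpha). assert (hj := pos_INR j). nra. }
    assert (h1 : 0 <= Rabs (binomial_coeff alpha j) * r ^ j)
      by (apply Rmult_le_pos; [apply Rabs_pos|apply pow_le; lra]).
    change (r ^ S j) with (r * r ^ j). change (s ^ S k) with (s * s ^ k).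
    replace (Rabs (binomial_coeff alpha j) * Rabs (alpha - INR j) * / INR (S j) * (r * r ^ j))
      with (Rabs (binomial_coeff alpha j) * r ^ j * (Rabs (alpha - INR j) * / INR (S j) * r)) by ring.
    assert (Hs : 0 <= s) by (unfold s; lra).
    apply Rle_trans with (Rabs (binomial_coeff alpha j) * r ^ j * s);
      [now apply Rmult_le_compat_l|].
    apply (Rmult_le_compat_r s) in IH; [|easy]. lra.
  - apply (@ex_series_scal R_AbsRing R_NormedModule
      (Rabs (binomial_coeff alpha M) * r ^ M) (fun k => s ^ k)).
    apply ex_series_geom. unfold s. rewrite Rabs_pos_eq; lra.
Qed.

(** The binomial series [Y] solves [(1 + u) Y' = alpha Y], so that
    [Y exp (- alpha log (1 + u))] has derivative zero. *)
Lemma binomial_series_Cpower (alpha : R) (u : C) :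
  in_disc u ->
  power_sum (fun k => RtoC (binomial_coeff alpha k)) u = Cpower (1 + u) (RtoC alpha).
Proof.
  intros Hu. unfold Cpower. rewrite Clog_series by easy.
  set (Y := power_sum (fun k => RtoC (binomial_coeff alpha k))).
  set (S := power_sum log_coeff).
  set (G := fun w => (Y w * Cexp (- alpha * S w))%C).
  assert (HY := binomial_unit_series alpha). fold Y in HY.
  assert (HG : forall z, in_disc z -> cderiv G z 0).
  { intros z Hz.
    assert (Hne := one_plus_neq_0 z Hz).
    destruct (unit_series_cderiv _ _ z HY Hz) as (d & Hd & Hs).
    assert (Hode : (d * (1 + z) = alpha * Y z)%C).
    { assert (H1 := proj1 (has_sum_drop _ _ 1%nat) Hs).
      assert (H2 := has_sum_scal z _ _ Hs).
      assert (H3 := has_sum_scal (RtoC alpha) _ _ (HY z Hz)).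
      apply (has_sum_unique _ _ _) with (2 := H3).
      replace (d * (1 + z))%C with
        (d - csum (fun k => INR k * binomial_coeff alpha k * z ^ pred k) 1 + z * d)%C
        by (simpl; ring).
      apply has_sum_ext with (2 := has_sum_plus _ _ _ _ H1 H2).
      intros k. cbv beta. change (1 + k)%nat with (Datatypes.S k). simpl pred.
      assert (E : (INR (Datatypes.S k) * binomial_coeff alpha (Datatypes.S k))%C
        = ((alpha - INR k) * binomial_coeff alpha k)%C).
      { rewrite <- RtoC_minus, <- !RtoC_mult. f_equal.
        cbn [binomial_coeff]. field. apply not_0_INR. lia. }
      rewrite E.
      destruct k as [|k]; [simpl; ring|]. simpl pred. rewrite Cpow_S. ring. }
    assert (Hexp := cderiv_comp Cexp _ z _ _ (cderiv_Cexp _)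
      (cderiv_comp (fun w => - alpha * w)%C S z _ _ (cderiv_linear _ _) (log_series_cderiv z Hz))).
    assert (H := cderiv_mult _ _ z _ _ Hd Hexp). cbv beta in H.
    replace (RtoC 0) with (d * Cexp (- alpha * S z) +
      Y z * (Cexp (- alpha * S z) * (- alpha * / (1 + z))))%C; [exact H|].
    replace d with (alpha * Y z / (1 + z))%C by (rewrite <- Hode; field; exact Hne).
    field. exact Hne. }
  assert (E := cderiv_zero_constant G u HG Hu). unfold G in E.
  rewrite (unit_series_at_0 _ _ HY) in E. unfold S in E at 2.
  rewrite (unit_series_at_0 _ _ log_unit_series) in E. simpl log_coeff in E. fold S in E.
  replace (- alpha * 0)%C with (RtoC 0) in E by ring. rewrite Cexp_0 in E.
  simpl binomial_coeff in E.
  transitivity (Y u * (Cexp (- alpha * S u) * Cexp (alpha * S u)))%C.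
  - rewrite <- Cexp_plus. replace (- alpha * S u + alpha * S u)%C with (RtoC 0) by ring.
    rewrite Cexp_0. ring.
  - rewrite Cmult_assoc, E. ring.
Qed.

(** * The extremal functions *)

(** The coefficients of [F (z ^ n)], when [a] are those of [F]. *)
Definition sparse (n : nat) (a : nat -> C) (k : nat) : C :=
  if (k mod n =? 0)%nat then a (k / n)%nat else RtoC 0.

Lemma sparse_mult (n j : nat) (a : nat -> C) : (1 <= n)%nat -> sparse n a (n * j) = a j.
Proof.
  intros Hn. unfold sparse. rewrite Nat.mul_comm, Nat.Div0.mod_mul. simpl.
  now rewrite Nat.div_mul by lia.
Qed.

(** In each block of [n] consecutive indices only the first one contributes, so
    a partial sum depends only on the number of blocks that it has entered. *)
Lemma csum_sparse (n : nat) (a : nat -> C) (z : C) (K r : nat) :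
  (1 <= n)%nat -> (1 <= r <= n)%nat ->
  csum (fun k => sparse n a k * z ^ k)%C (n * K + r)
  = csum (fun k => a k * (z ^ n) ^ k)%C (S K).
Proof.
  intros Hn. revert r.
  assert (Hblock : forall K r, (1 <= r <= n)%nat ->
    csum (fun k => sparse n a (n * K + k) * z ^ (n * K + k))%C r = (a K * (z ^ n) ^ K)%C).
  { intros J [|r] Hr; [lia|]. rewrite csum_shift, Nat.add_0_r, sparse_mult, Cpow_mult_r by lia.
    rewrite csum_ext with (b := fun _ => RtoC 0); [rewrite csum_zero; ring|].
    intros k Hk. unfold sparse.
    replace (n * J + S k)%nat with (S k + J * n)%nat by lia.
    rewrite Nat.Div0.mod_add, Nat.mod_small by lia. simpl. ring. }
  induction K as [|K IH]; intros r Hr; rewrite csum_add, Hblock by easy.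
  - rewrite Nat.mul_0_r. reflexivity.
  - replace (n * S K)%nat with (n * K + n)%nat by lia. rewrite IH by lia. reflexivity.
Qed.

Lemma in_disc_pow (n : nat) (z : C) : (1 <= n)%nat -> in_disc z -> in_disc (z ^ n).
Proof.
  unfold in_disc. intros Hn Hz. rewrite Cmod_pow. assert (h := Cmod_ge_0 z).
  apply pow_lt_1_compat; [lra|lia].
Qed.

Lemma unit_series_sparse (n : nat) (a : nat -> C) (F : C -> C) :
  (1 <= n)%nat -> unit_series a F -> unit_series (sparse n a) (fun z => F (z ^ n)%C).
Proof.
  intros Hn HF z Hz eps Heps.
  assert (Hzn := in_disc_pow n z Hn Hz).
  destruct (HF _ Hzn eps Heps) as [N HN].
  exists (n * N + 1)%nat. intros m Hm.
  assert (Hdiv := Nat.div_mod_eq (m - 1) n).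
  assert (Hmod := Nat.mod_upper_bound (m - 1) n ltac:(lia)).
  set (K := ((m - 1) / n)%nat) in *. set (s := ((m - 1) mod n)%nat) in *.
  replace m with (n * K + S s)%nat by lia.
  rewrite csum_sparse by lia. apply HN.
  assert (n * N < n * S K)%nat by lia. nia.
Qed.

Lemma unit_series_scale (a : nat -> C) (F : C -> C) (b : C) :
  Cmod b <= 1 -> unit_series a F ->
  unit_series (fun k => a k * b ^ k)%C (fun z => F (b * z)%C).
Proof.
  intros Hb HF z Hz.
  eapply has_sum_ext; [|apply (HF (b * z)%C)].
  - intros k. cbv beta. rewrite Cpow_mult_l. ring.
  - unfold in_disc in *. rewrite Cmod_mult.
    assert (h := Cmod_ge_0 z). assert (h2 := Cmod_ge_0 b). nra.
Qed.

Lemma unit_series_scal (c : C) (a : nat -> C) (F : C -> C) :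
  unit_series a F -> unit_series (fun k => c * a k)%C (fun z => c * F z)%C.
Proof.
  intros HF z Hz. apply has_sum_ext with (2 := has_sum_scal c _ _ (HF z Hz)).
  intros; ring.
Qed.

Lemma unit_series_ext (a : nat -> C) (F G : C -> C) :
  (forall z, in_disc z -> F z = G z) -> unit_series a F -> unit_series a G.
Proof. intros E H z Hz. rewrite <- E by easy. now apply H. Qed.

Lemma unit_series_cons (c : C) (a : nat -> C) (F : C -> C) :
  unit_series a F ->
  unit_series (fun k => match k with O => c | S j => a j end) (fun z => c + z * F z)%C.
Proof.
  intros H z Hz. apply (has_sum_drop _ _ 1%nat).
  replace (c + z * F z - csum _ 1)%C with (z * F z)%C by (simpl; ring).
  apply has_sum_ext with (2 := has_sum_scal z _ _ (H z Hz)).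
  intros k. simpl. ring.
Qed.

Lemma geometric_unit_series : unit_series (fun _ => RtoC 1) (fun z => / (1 - z))%C.
Proof.
  intros z Hz. apply has_sum_ext with (2 := has_sum_geometric z Hz). intros; ring.
Qed.

Definition kfun_log (A B : R) (n : nat) (z : C) : C :=
  (((A - B) / (INR n * B))%R * Clog (1 + B * z ^ n))%C.

Definition kfun_log_coeff (A B : R) (n : nat) : nat -> C :=
  sparse n (fun j => ((A - B) / (INR n * B))%R * (log_coeff j * B ^ j))%C.

Lemma kfun_exp (A B : R) (n : nat) (z : C) :
  kfun A B n z = (z * Cexp (kfun_log A B n z))%C.
Proof. reflexivity. Qed.

Lemma in_disc_scaled_pow (B : R) (n : nat) (z : C) :
  -1 <= B <= 1 -> (1 <= n)%nat -> in_disc z -> in_disc (B * z ^ n).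
Proof.
  intros HB Hn Hz. now apply in_disc_scaled, in_disc_pow.
Qed.

Lemma kfun_log_unit_series (A B : R) (n : nat) :
  -1 <= B <= 1 -> (1 <= n)%nat -> unit_series (kfun_log_coeff A B n) (kfun_log A B n).
Proof.
  intros HB Hn.
  apply unit_series_ext with
    (fun z => ((A - B) / (INR n * B))%R * power_sum log_coeff (B * z ^ n))%C.
  - intros z Hz. unfold kfun_log. rewrite Clog_series; [easy|].
    now apply in_disc_scaled_pow.
  - apply (unit_series_sparse n _
      (fun u => ((A - B) / (INR n * B))%R * power_sum log_coeff (B * u))%C Hn).
    apply (unit_series_scal _ _ (fun u => power_sum log_coeff (B * u))).
    apply unit_series_scale; [rewrite Cmod_R; now apply Rabs_le|apply log_unit_series].
Qed.

Lemma kfun_unit_series (A B : R) (n : nat) :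
  -1 <= B <= 1 -> (1 <= n)%nat -> exists a, unit_series a (kfun A B n).
Proof.
  intros HB Hn. set (alpha := (A - B) / (INR n * B)).
  set (b := sparse n (fun j => (binomial_coeff alpha j * B ^ j)%C)).
  exists (fun k => match k with O => RtoC 0 | S j => b j end).
  apply unit_series_ext with
    (fun z => 0 + z * power_sum (fun k => RtoC (binomial_coeff alpha k)) (B * z ^ n))%C.
  - intros z Hz. unfold kfun. fold alpha.
    rewrite binomial_series_Cpower by now apply in_disc_scaled_pow. ring.
  - apply (unit_series_cons 0 b
      (fun z => power_sum (fun k => RtoC (binomial_coeff alpha k)) (B * z ^ n)%C)).
    apply (unit_series_sparse n _
      (fun u => power_sum (fun k => RtoC (binomial_coeff alpha k)) (B * u)%C) Hn).
    apply unit_series_scale; [rewrite Cmod_R; now apply Rabs_le|apply binomial_unit_series].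
Qed.

(** Multiplying the [k]-th coefficient of the logarithmic series by [k] removes
    its denominator and leaves a geometric series, whose sum is
    [z L' = (A - B) z ^ n / (1 + B z ^ n)]. *)
Lemma kfun_log_deriv_unit_series (A B : R) (n : nat) :
  -1 <= B <= 1 -> B <> 0 -> (1 <= n)%nat ->
  unit_series (fun k => INR k * kfun_log_coeff A B n k)%C
    (fun z => z ^ n * ((A - B) / (1 + B * z ^ n)))%C.
Proof.
  intros HB HB0 Hn.
  set (e := fun k => match k with O => RtoC 0 | S j => ((A - B)%R * (1 * (- B)%R ^ j))%C end).
  assert (He : unit_series e (fun u => 0 + u * ((A - B)%R * / (1 - (- B)%R * u)))%C).
  { apply (unit_series_cons 0 _ (fun u => (A - B)%R * / (1 - (- B)%R * u))%C).
    apply (unit_series_scal _ _ (fun u => / (1 - (- B)%R * u))%C).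
    apply (unit_series_scale _ (fun u => / (1 - u))%C); [|apply geometric_unit_series].
    rewrite Cmod_R, Rabs_Ropp. now apply Rabs_le. }
  assert (Hs := unit_series_sparse n _ _ Hn He).
  intros z Hz. specialize (Hs z Hz). cbv beta in Hs.
  replace (z ^ n * ((A - B) / (1 + B * z ^ n)))%C
    with (0 + z ^ n * ((A - B)%R * / (1 - (- B)%R * z ^ n)))%C.
  - apply has_sum_ext with (2 := Hs). intros k. f_equal.
    unfold kfun_log_coeff, sparse.
    destruct (k mod n =? 0)%nat eqn:Ek; [|ring].
    apply Nat.eqb_eq in Ek.
    assert (Hk : k = (n * (k / n))%nat) by (rewrite (Nat.div_mod_eq k n) at 1; lia).
    set (j := (k / n)%nat) in *. rewrite Hk, mult_INR.
    assert (HnR : INR n <> 0) by (apply not_0_INR; lia).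
    destruct j as [|j]; unfold e, log_coeff; [ring|].
    assert (HjR : INR (S j) <> 0) by (apply not_0_INR; lia).
    rewrite <- !RtoC_pow, <- !RtoC_mult. f_equal.
    replace (- B) with (-1 * B) by ring. rewrite Rpow_mult_distr.
    change (B ^ S j) with (B * B ^ j). field. now repeat split.
  - rewrite RtoC_opp, RtoC_minus. unfold Cdiv.
    replace (1 - - B * z ^ n)%C with (1 + B * z ^ n)%C by ring. ring.
Qed.

(** Here [z f' / f = (1 + A z ^ n) / (1 + B z ^ n)], with [z ^ n] as the
    Schwarz function. *)
Lemma kfun_starlike (A B : R) (n : nat) :
  -1 <= B -> B < A -> A <= 1 -> B <> 0 -> (1 <= n)%nat -> starlike_class A B (kfun A B n).
Proof.
  intros hB hBA hA HB0 Hn. assert (HB : -1 <= B <= 1) by lra.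
  assert (HL := kfun_log_unit_series A B n HB Hn).
  assert (HD := kfun_log_deriv_unit_series A B n HB HB0 Hn).
  assert (Hderiv : forall z, in_disc z -> C_derive (kfun A B n) z
    = (Cexp (kfun_log A B n z) * (1 + z ^ n * ((A - B) / (1 + B * z ^ n))))%C).
  { intros z Hz.
    destruct (C_derive_z_exp (kfun A B n) _ _ z HL (fun w _ => kfun_exp A B n w) Hz)
      as (s & Hs & E).
    rewrite E. do 2 f_equal. exact (has_sum_unique _ _ _ Hs (HD z Hz)). }
  assert (H0 : in_disc (RtoC 0)) by (unfold in_disc; rewrite Cmod_0; lra).
  assert (Hpow0 : (RtoC 0 ^ n)%C = RtoC 0) by (destruct n; [lia|rewrite Cpow_S; ring]).
  assert (Hden : forall z, in_disc z -> (1 + B * z ^ n)%C <> RtoC 0).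
  { intros z Hz. now apply one_plus_neq_0, in_disc_scaled_pow. }
  split; [split; [|split]|split].
  - destruct (kfun_unit_series A B n HB Hn) as [a Ha]. exact (unit_series_analytic a _ Ha).
  - rewrite kfun_exp. ring.
  - rewrite Hderiv, Hpow0 by easy.
    rewrite (unit_series_at_0 _ _ HL). unfold kfun_log_coeff, sparse.
    rewrite Nat.Div0.mod_0_l, Nat.Div0.div_0_l. simpl.
    replace (_ * (0 * 1))%C with (RtoC 0) by ring. rewrite Cexp_0. ring.
  - intros z Hz Hz0. rewrite kfun_exp. apply Cmult_neq_0; [easy|apply Cexp_neq_0].
  - exists (fun z => 1 + z ^ n * ((A - B) / (1 + B * z ^ n)))%C. split; [|split].
    + apply (unit_series_analytic
        (fun k => sparse n (fun j => match j with O => RtoC 1 | S _ => RtoC 0 end) k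
                  + INR k * kfun_log_coeff A B n k)%C).
      intros z Hz.
      assert (H1 : unit_series (fun j => match j with O => RtoC 1 | S _ => RtoC 0 end)
        (fun u => 1 + u * 0)%C).
      { apply (unit_series_cons 1 (fun _ => RtoC 0) (fun _ => RtoC 0)).
        intros u _. apply has_sum_ext with (2 := has_sum_zero). intros; ring. }
      assert (H2 := unit_series_sparse n _ _ Hn H1 z Hz). cbv beta in H2.
      replace (1 + z ^ n * 0)%C with (RtoC 1) in H2 by ring.
      apply has_sum_ext with (2 := has_sum_plus _ _ _ _ H2 (HD z Hz)).
      intros; ring.
    + intros z Hz Hz0. rewrite Hderiv, kfun_exp by easy. field.
      auto using Cexp_neq_0.
    + exists (fun z => z ^ n)%C. split; [|split].
      * apply (unit_series_analytic (sparse n (fun j => match j with 1%nat => RtoC 1 | _ => RtoC 0 end))).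
        apply (unit_series_sparse n _ (fun u => u) Hn).
        intros u Hu eps Heps. exists 2%nat. intros m Hm.
        replace m with (2 + (m - 2))%nat by lia. rewrite csum_add.
        rewrite (csum_ext _ (fun _ => RtoC 0) (m - 2)) by (intros; simpl; ring).
        rewrite csum_zero. simpl. replace (_ - u)%C with (RtoC 0) by ring.
        now rewrite Cmod_0.
      * exact Hpow0.
      * intros z Hz. split; [|field; now apply Hden].
        now apply in_disc_pow.
Qed.

Lemma kfun_log_coeffs (A B : R) (n : nat) :
  -1 <= B <= 1 -> (1 <= n)%nat ->
  log_coeffs (kfun A B n) (fun k => kfun_log_coeff A B n k / 2)%C.
Proof.
  intros HB Hn. assert (HL := kfun_log_unit_series A B n HB Hn).
  assert (Hl0 : kfun_log_coeff A B n 0 = RtoC 0).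
  { unfold kfun_log_coeff, sparse. rewrite Nat.Div0.mod_0_l, Nat.Div0.div_0_l. simpl. ring. }
  exists (kfun_log A B n). split; [split; [|split]|].
  - exact (unit_series_analytic _ _ HL).
  - now rewrite (unit_series_at_0 _ _ HL).
  - intros z Hz Hz0. rewrite kfun_exp. field. exact Hz0.
  - intros z Hz. apply has_sum_is_series.
    assert (H := proj1 (has_sum_drop _ _ 1%nat) (HL z Hz)).
    replace (kfun_log A B n z) with
      (kfun_log A B n z - csum (fun k => kfun_log_coeff A B n k * z ^ k) 1)%C
      by (simpl; rewrite Hl0; ring).
    apply has_sum_ext with (2 := H). intros k. cbv beta.
    change (1 + k)%nat with (S k). field.
Qed.

Lemma kfun_log_coeff_mult (A B : R) (n j : nat) :
  B <> 0 -> B < A -> (1 <= n)%nat ->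
  Cmod (kfun_log_coeff A B n (n * S j) / 2)%C
  = (A - B) / (2 * INR (n * S j)) * Rabs B ^ j.
Proof.
  intros HB0 HBA Hn. unfold kfun_log_coeff. rewrite sparse_mult by easy. unfold log_coeff.
  rewrite <- RtoC_pow, <- !RtoC_mult.
  assert (HnR : 0 < INR n) by (apply lt_0_INR; lia).
  assert (HjR : 0 < INR (S j)) by (apply lt_0_INR; lia).
  assert (H2 : RtoC 2 <> RtoC 0) by (intros E; apply RtoC_inj in E; lra).
  rewrite Cmod_div, !Cmod_R, (Rabs_pos_eq 2) by (easy || lra).
  change (B ^ S j) with (B * B ^ j).
  replace ((A - B) / (INR n * B) * ((-1) ^ j / INR (S j) * (B * B ^ j)))
    with ((A - B) / (INR n * INR (S j)) * ((-1) ^ j * B ^ j)) by (field; lra).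
  rewrite !Rabs_mult, pow_1_abs, <- RPow_abs, mult_INR, Rabs_pos_eq.
  - field. lra.
  - apply Rdiv_le_0_compat; [lra|]. now apply Rmult_lt_0_compat.
Qed.

Theorem theorem2p1 (A B : R) (hB : -1 <= B) (hBA : B < A) (hA : A <= 1)
    (hB0 : B <> 0) :
  (forall (f : C -> C) (gamma : nat -> C),
     starlike_class A B f -> log_coeffs f gamma ->
     (forall n : nat, (1 <= n)%nat -> Cmod (gamma n) <= (A - B) / (2 * INR n)) /\
     ex_series (fun k : nat => Cmod (gamma (S k)) ^ 2) /\
     Series (fun k : nat => Cmod (gamma (S k)) ^ 2)
       <= ((A - B) / (2 * B)) ^ 2 * Li2 (B ^ 2)) /\
  (forall n : nat, (1 <= n)%nat ->
     starlike_class A B (kfun A B n) /\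
     exists gamma : nat -> C,
       log_coeffs (kfun A B n) gamma /\
       Cmod (gamma n) = (A - B) / (2 * INR n)) /\
  (exists gamma : nat -> C,
     log_coeffs (kfun A B 1) gamma /\
     is_series (fun k : nat => Cmod (gamma (S k)) ^ 2)
       (((A - B) / (2 * B)) ^ 2 * Li2 (B ^ 2))).
Proof.
  split; [|split].
  - intros f gamma Hf Hg. now apply (starlike_log_coeff_bounds A B f gamma).
  - intros n Hn. split; [now apply kfun_starlike|].
    eexists. split; [apply kfun_log_coeffs; [lra|easy]|]. cbv beta.
    assert (H := kfun_log_coeff_mult A B n 0 hB0 hBA Hn).
    rewrite Nat.mul_1_r in H. rewrite H. simpl. ring.
  - eexists. split; [apply kfun_log_coeffs; [lra|easy]|]. cbv beta.
    assert (HB2 : 0 <= B ^ 2 <= 1) by nra.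
    assert (Hs := Series_correct _ (Li2_ex_series (B ^ 2) HB2)).
    apply (@is_series_scal R_AbsRing R_NormedModule (((A - B) / (2 * B)) ^ 2)) in Hs.
    apply is_series_ext with (2 := Hs). intros k.
    change (((A - B) / (2 * B)) ^ 2 * ((B ^ 2) ^ S k / INR (S k) ^ 2)
      = Cmod (kfun_log_coeff A B 1 (S k) / 2)%C ^ 2).
    assert (H := kfun_log_coeff_mult A B 1 k hB0 hBA (le_n _)).
    rewrite Nat.mul_1_l in H. rewrite H.
    assert (E : (Rabs B ^ k) ^ 2 = (B ^ 2) ^ k)
      by (rewrite <- (pow2_abs B), <- !pow_mult; f_equal; lia).
    rewrite (Rpow_mult_distr _ (Rabs B ^ k)), E.
    change ((B ^ 2) ^ S k) with (B ^ 2 * (B ^ 2) ^ k).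
    field. split; [apply not_0_INR; lia|easy].
Qed.
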